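(* Let $d=1$, let $(\Omega,\mathcal{F},\mathbb{P})$ be a probability space with an invertible ergodic measure-preserving transformation $T$, and let $p^+,p^-:\Omega\to[0,1]$ be measurable with $p^++p^-=1$ and $\int|\log p^{\pm}|\,d\mathbb{P}<\infty$. Let $I(x)=\sup_{\lambda\in\mathbb{R}}\{\lambda x-\Lambda(\lambda)\}$. Then for $\mathbb{P}$-almost every $\omega$, $X_n/n$ under $P_\omega$ obeys a large deviation principle with rate function $I$: $\limsup_n\frac1n\log P_\omega[X_n/n\in C]\le-\inf_C I$ for every closed $C\subset\mathbb{R}$ and $\liminf_n\frac1n\log P_\omega[X_n/n\in O]\ge-\inf_O I$ for every open $O\subset\mathbb{R}$.
   Context: $P_\omega$ is the law of the random walk $(X_n)$ on $\mathbb{Z}$ with $X_0=0$ which, from $x$, steps to $x+1$ with probability $p^+(T^x\omega)$ and to $x-1$ with probability $p^-(T^x\omega)$. The class $\mathcal{K}$ consists of pairs of functions $F^\pm\in L^1(\mathbb{P})$ with $\mathbb{E}[F^\pm]=0$ and $F^+(\omega)+F^-(T\omega)=0$. Define $$\Lambda(\lambda)=\inf_{F\in\mathcal{K}}\operatorname*{ess\,sup}_\omega\log\left\{p^+(\omega)\mathrm{e}^{\lambda+F^+(\omega)}+p^-(\omega)\mathrm{e}^{-\lambda+F^-(\omega)}\right\}.$$ *)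

(* Defs.v *)
From HB Require Import structures.
From mathcomp Require Import all_boot all_order all_algebra.
From mathcomp Require Import all_classical all_reals all_analysis.
From mathcomp Require Import ess_sup_inf.
Set Implicit Arguments. Unset Strict Implicit. Unset Printing Implicit Defensive.
Import Order.TTheory GRing.Theory Num.Theory.
Import numFieldNormedType.Exports.
Local Open Scope classical_set_scope.
Local Open Scope ring_scope.

Section Defs.
Context {R : realType} {T : Type}.

Definition Tpow (Tf Ti : T -> T) (z : int) : T -> T :=
  match z with
  | Posz n => iter n Tf
  | Negz n => iter n.+1 Ti
  end.

Variables (Tf Ti : T -> T) (pp pm : T -> R) (w : T).

Fixpoint walk_end (x : int) (s : seq bool) : int :=
  match s with
  | [::] => x
  | b :: s' => walk_end (if b then x + 1 else x - 1) s'
  end.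

Fixpoint walk_prob (x : int) (s : seq bool) : R :=
  match s with
  | [::] => 1
  | b :: s' => (if b then pp (Tpow Tf Ti x w) else pm (Tpow Tf Ti x w))
                 * walk_prob (if b then x + 1 else x - 1) s'
  end.

Definition quenched_prob (n : nat) (A : set R) : R :=
  \sum_(s : n.-tuple bool | `[< A ((walk_end 0 s)%:~R / n%:R) >]) walk_prob 0 s.

End Defs.

Definition elog {R : realType} (x : R) : \bar R :=
  if x == 0 then -oo%E else (ln x)%:E.

Section Lambda.
Context {d : measure_display} {T : measurableType d} {R : realType}.
Variables (P : probability T R) (Tf : T -> T) (pp pm : T -> R).

Definition classK (F : (T -> R) * (T -> R)) : Prop :=
  [/\ P.-integrable setT (EFin \o F.1), P.-integrable setT (EFin \o F.2),
      (\int[P]_x (F.1 x)%:E = 0)%E, (\int[P]_x (F.2 x)%:E = 0)%E &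
      forall x, F.1 x + F.2 (Tf x) = 0].

Definition Lambda (l : R) : \bar R :=
  ereal_inf [set ess_sup P (fun x =>
      (ln (pp x * expR (l + F.1 x) + pm x * expR (- l + F.2 x)))%:E)
    | F in classK].

Definition rateI (x : R) : \bar R :=
  ereal_sup [set ((l * x)%:E - Lambda l)%E | l in [set: R]].

End Lambda.

(* Main.v *)
(**
Upper bound. For F in K the sum of F along a path of the walk depends only on
its endpoint z, and by the ergodic theorem it is o(|z|). If the essential
supremum defining Lambda is < r at F, then E[exp(l X_n + o(n))] <= exp(r n),
and Chernoff's inequality for the half-lines {l x - r > a}, finitely many of
which cover C `&` [-1, 1], concludes.

Lower bound, 0 < v < 1. Let H be the passage time from 0 to 1 and
g_N(r) = E[ln E_omega[e^(-r H); H <= N]]. At a minimizer r_N of v g_N(r) + r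
the tilted passage times have mean 1/v, so the product of the generating
functions along the orbit is concentrated near degree m / v; hence
lim inf (1/n) ln P_omega(X_n ~ n v) >= v g_N(r_N) + r_N. If these minima stay
below alpha, a cluster point r of (r_N) has v g_N(r) + r <= alpha for all N.
The limit in N of ln E_omega[e^(-r H); H <= N] then yields, by the first-step
decomposition of H, an element of K showing Lambda(l) <= l v + alpha for some
l, that is, - I(v) <= alpha. Negative speeds follow by reflection and the
endpoints -1, 0, 1 by convexity of I.
*)
Require Import Defs.
From HB Require Import structures.
From mathcomp Require Import all_boot all_order all_algebra.
From mathcomp Require Import all_classical all_reals all_analysis.
From mathcomp Require Import ess_sup_inf.
From mathcomp Require Import finmap measurable_realfun ring lra zify.
Set Implicit Arguments. Unset Strict Implicit. Unset Printing Implicit Defensive.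
Import Order.TTheory GRing.Theory Num.Theory.
Import numFieldNormedType.Exports.
Local Open Scope classical_set_scope.
Local Open Scope ring_scope.

(** The passage time is truncated at N because e^(-r H) may fail to be integrable for r < 0, which
    slow speeds can call for. After truncation the generating function is a polynomial in e^(-r)
    whose logarithm is integrable and Lipschitz in r. It is never differentiated: an upper bound of
    order (N eta)^2 on its second difference, combined with minimality at r_N, places g_N(r_N +-
    eta) below the line of slope - 1 / v up to a small error, and this is all that the exponential
    Chebyshev inequality needs. Concentration then comes from the ergodic theorem for T alone,
    without an invariant measure for the environment seen from the walker, since a passage to m is
    made of m unit passages along the orbit. The null set must depend neither on the closed or open
    set nor on the level alpha. Hence half-lines are indexed by rational pairs, speeds are rational,
    and the ergodic theorem is stated with an error e n + B that is kept until the parameters are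
    fixed. *)

Section Integrable.
Context {d : measure_display} {T : measurableType d} {R : realType}.
Variable P : probability T R.
Implicit Types f g : T -> R.

Definition intg f : Prop := P.-integrable setT (EFin \o f).

Lemma intg_measurable f : intg f -> measurable_fun setT f.
Proof. by move=> /measurable_int /measurable_EFinP. Qed.

Lemma intg_cst (c : R) : intg (cst c).
Proof.
apply: (@finite_measure_integrable_cst _ _ _ P setT); exact: measurableT.
Qed.

Lemma intgD f g : intg f -> intg g -> intg (fun x => f x + g x).
Proof. by move=> If Ig; apply: (integrableD _ If Ig). Qed.

Lemma intgB f g : intg f -> intg g -> intg (fun x => f x - g x).
Proof. by move=> If Ig; apply: (integrableB _ If Ig). Qed.

Lemma intgN f : intg f -> intg (fun x => - f x).
Proof. by move=> If; apply: (integrableN If). Qed.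

Lemma intgZ (c : R) f : intg f -> intg (fun x => c * f x).
Proof. by move=> If; apply: (integrableZl _ _ If). Qed.

Lemma intg_le f g : measurable_fun setT f -> intg g ->
  (forall x, `|f x| <= g x) -> intg f.
Proof.
move=> mf Ig fg; apply: (le_integrable _ _ _ Ig) => //.
  exact/measurable_EFinP.
move=> x _ /=; rewrite lee_fin; exact: le_trans (fg x) (ler_norm _).
Qed.

Lemma intg_norm f : intg f -> intg (fun x => `|f x|).
Proof. by move=> If; apply: integrable_norm. Qed.

Lemma intg_max f g : intg f -> intg g -> intg (fun x => Num.max (f x) (g x)).
Proof.
move=> If Ig; have Ifg := intgD (intg_norm If) (intg_norm Ig).
apply: intg_le Ifg _.
  exact: measurable_maxr (intg_measurable If) (intg_measurable Ig).
move=> x; rewrite maxEle; case: ifP => _.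
  by rewrite lerDr.
by rewrite lerDl.
Qed.

Lemma Rint_EFin f : intg f -> (\int[P]_x (f x)%:E = (\int[P]_x f x)%:E)%E.
Proof.
by move=> If; rewrite /Rintegral fineK//; exact: integrable_fin_num.
Qed.

Lemma Rint_cst (c : R) : \int[P]_x c = c.
Proof. by rewrite Rintegral_cst// [X in fine X]probability_setT/= mulr1. Qed.

Lemma RintD f g : intg f -> intg g ->
  \int[P]_x (f x + g x) = \int[P]_x f x + \int[P]_x g x.
Proof. by move=> If Ig; apply: RintegralD. Qed.

Lemma RintB f g : intg f -> intg g ->
  \int[P]_x (f x - g x) = \int[P]_x f x - \int[P]_x g x.
Proof. by move=> If Ig; apply: RintegralB. Qed.

Lemma RintZ (c : R) f : intg f -> \int[P]_x (c * f x) = c * \int[P]_x f x.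
Proof. by move=> If; apply: RintegralZl. Qed.

Lemma Rint_addc (c : R) f : intg f -> \int[P]_x (c + f x) = c + \int[P]_x f x.
Proof. by move=> If; rewrite (RintD (intg_cst c) If) Rint_cst. Qed.

Lemma RintN f : intg f -> \int[P]_x (- f x) = - \int[P]_x f x.
Proof.
move=> If; rewrite -mulN1r -RintZ//.
by apply: eq_Rintegral => x _; rewrite mulN1r.
Qed.

Lemma le_Rint f g : intg f -> intg g -> (forall x, f x <= g x) ->
  \int[P]_x f x <= \int[P]_x g x.
Proof. by move=> If Ig fg; apply: le_Rintegral. Qed.

Lemma ae_ex (Q : T -> Prop) : (\forall x \ae P, Q x) -> exists x, Q x.
Proof.
move=> aeQ.
have P0 : (0 < P setT)%E by rewrite probability_setT.
have FF : ProperFilter (almost_everywhere P) := ae_properfilter_algebraOfSetsType P0.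
exact: filter_ex aeQ.
Qed.

End Integrable.

(** * Ergodic sums *)

Section Birkhoff.
Context {T : Type} {R : realType}.
Variable S : T -> T.
Implicit Types f : T -> R.

Definition birkhoff f n w : R := \sum_(i < n) f (iter i S w).

Lemma birkhoff0 f w : birkhoff f 0 w = 0.
Proof. by rewrite /birkhoff big_ord0. Qed.

Lemma birkhoffS f n w : birkhoff f n.+1 w = f w + birkhoff f n (S w).
Proof.
rewrite /birkhoff big_ord_recl /=; congr (_ + _).
by apply: eq_bigr => i _; rewrite -iterS iterSr.
Qed.

(** Maximum of the ergodic sums of index at most n, in the recursive form that Garsia's argument
    uses. *)
Fixpoint birkhoff_max f n w : R :=
  if n is n'.+1 then Num.max 0 (f w + birkhoff_max f n' (S w)) else 0.

Lemma birkhoff_max_ge0 f n w : 0 <= birkhoff_max f n w.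
Proof. by case: n => [|n] //=; rewrite le_max lexx. Qed.

Lemma birkhoff_le_max f n w : birkhoff f n w <= birkhoff_max f n w.
Proof.
elim: n w => [|n IH] w /=; first by rewrite birkhoff0.
by rewrite birkhoffS le_max lerD2l IH orbT.
Qed.

Lemma birkhoff_max_nd f n w : birkhoff_max f n w <= birkhoff_max f n.+1 w.
Proof.
elim: n w => [|n IH] w /=; first by rewrite le_max lexx.
by rewrite ge_max le_max lexx/= le_max lerD2l (IH (S w)) orbT.
Qed.

End Birkhoff.

Section Ergodic.
Context {d : measure_display} {T : measurableType d} {R : realType}.
Variables (P : probability T R) (S : T -> T).
Hypothesis mS : measurable_fun setT S.
Hypothesis SP : forall A, measurable A -> P (S @^-1` A) = P A.
Implicit Types f g : T -> R.

Lemma eq_integral_pushforward (f : T -> \bar R) :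
  (\int[pushforward P S]_x f x = \int[P]_x f x)%E.
Proof. by apply: eq_measure_integral => A mA _; apply: SP. Qed.

Lemma intg_comp f : intg P f -> intg P (f \o S).
Proof.
move=> /integrableP[mf fi]; apply/integrableP; split.
  exact: (measurableT_comp mf mS).
have := @ge0_integral_pushforward _ _ _ _ _ S mS P setT (fun x => `|(f x)%:E|)%E
  measurableT.
rewrite eq_integral_pushforward preimage_setT /= => <- //.
by apply/measurable_EFinP/measurableT_comp => //; exact/measurable_EFinP.
Qed.

Lemma Rint_comp f : intg P f -> \int[P]_x f (S x) = \int[P]_x f x.
Proof.
move=> If; rewrite /Rintegral -[in RHS]eq_integral_pushforward.
rewrite (integral_pushforward mS (measurable_int _ If) _ measurableT) //.
exact: (intg_comp If).
Qed.

Lemma ae_comp (Q : T -> Prop) : (\forall x \ae P, Q x) -> \forall x \ae P, Q (S x).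
Proof.
move=> [N [mN PN subN]]; exists (S @^-1` N); split.
- by rewrite -[_ @^-1` _]setTI; exact: mS.
- by rewrite SP.
- by move=> x; exact: subN.
Qed.

Lemma ae_iter (Q : T -> Prop) : (\forall x \ae P, Q x) ->
  \forall x \ae P, forall n, Q (iter n S x).
Proof.
move=> aeQ; apply/ae_foralln; elim=> [|n IH] //.
have := ae_comp IH; apply: filterS => x.
by rewrite -iterSr.
Qed.

Lemma intg_birkhoff f n : intg P f -> intg P (birkhoff S f n).
Proof.
move=> If; elim: n => [|n IH].
  have -> : birkhoff S f 0 = cst 0 by apply/funext => w; rewrite birkhoff0.
  exact: intg_cst.
have -> : birkhoff S f n.+1 = (fun w => f w + (birkhoff S f n \o S) w).
  by apply/funext => w; rewrite birkhoffS.
by apply: intgD => //; exact: intg_comp.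
Qed.

Lemma intg_birkhoff_max f n : intg P f -> intg P (birkhoff_max S f n).
Proof.
move=> If; elim: n => [|n IH]; first exact: intg_cst.
apply: (@intg_max _ _ _ P (cst 0)); first exact: intg_cst.
by apply: intgD => //; exact: intg_comp IH.
Qed.

(* Garsia: M_{n+1} - M_n o S = max (- M_n o S) f has nonnegative integral, and
   tends to f wherever the maxima M_n are unbounded. *)
Lemma unbounded_birkhoff_ge0 f : intg P f ->
  (\forall w \ae P, forall B, exists n, B < birkhoff S f n w) ->
  0 <= \int[P]_x f x.
Proof.
move=> If unb.
pose D n w := birkhoff_max S f n.+1 w - birkhoff_max S f n (S w).
have DE n w : D n w = Num.max (- birkhoff_max S f n (S w)) (f w).
  by rewrite /D /= addr_maxl sub0r addrK.
have ID n : intg P (D n).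
  apply: intgB; first exact: intg_birkhoff_max.
  exact: intg_comp (intg_birkhoff_max _ If).
have intD n : 0 <= \int[P]_x D n x.
  have IM k : intg P (birkhoff_max S f k) := intg_birkhoff_max k If.
  rewrite /D (RintB (IM _) (intg_comp (IM n))) (Rint_comp (IM n)) subr_ge0.
  exact: le_Rint (IM _) (IM _) (birkhoff_max_nd _ _ _).
have Df : {ae P, forall x, setT x -> (EFin \o D n) x @[n --> \oo] --> (EFin \o f) x}.
  have := ae_comp unb; apply: filterS => w Hw _ /=.
  have [n Hn] := Hw (- f w).
  have {}Hn : - f w < birkhoff_max S f n (S w) := lt_le_trans Hn (birkhoff_le_max _ _ _ _).
  apply: cvg_near_cst; exists n => // m /= nm.
  rewrite DE; congr (_%:E); apply/max_idPr.
  rewrite lerNl; apply: (le_trans (ltW Hn)).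
  apply: (@homo_leq _ (fun k => birkhoff_max S f k (S w)) <=%R) nm => //.
    by move=> ? ? ?; exact: le_trans.
  by move=> k; exact: birkhoff_max_nd.
(* As [birkhoff_max] is nonnegative, [D n] lies between [f] and the maximum of 0 and [f]. *)
have Dle : {ae P, forall x n, setT x -> (`|(EFin \o D n) x| <= `|f x|%:E)%E}.
  apply: aeW => w n _ /=; rewrite lee_fin DE.
  have := birkhoff_max_ge0 S f n (S w); have := ler_norm (f w).
  have := ler_norm (- f w); rewrite normrN => *.
  by rewrite maxEle; case: ifP => //; rewrite ler_norml; lra.
have [_ _] := dominated_convergence measurableT (fun n => measurable_int _ (ID n))
  (measurable_int _ If) Df (intg_norm If) Dle.
rewrite /comp /= (Rint_EFin If) => H.
rewrite -lee_fin; apply: (cvge_ge _ H); apply: nearW => n.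
by rewrite Rint_EFin// lee_fin.
Qed.

Hypothesis erg : forall A, measurable A -> S @^-1` A = A -> P A = 0%E \/ P A = 1%E.

(** Unboundedness is invariant under [S], so by ergodicity it has probability 0 or 1; probability 1
    would make the integral nonnegative. *)
Lemma birkhoff_bounded_above f : intg P f -> \int[P]_x f x < 0 ->
  \forall w \ae P, exists B, forall n, birkhoff S f n w <= B.
Proof.
move=> If f0.
pose A := [set w | forall B, exists n, B < birkhoff S f n w].
have AC : ~` A = [set w | exists B, forall n, birkhoff S f n w <= B].
  apply/seteqP; split => w /=.
    move=> /existsNP[B /forallNP HB]; exists B => n.
    by rewrite leNgt; apply/negP/HB.
  by move=> [B HB] /(_ B)[n]; rewrite ltNge HB.
have Aeq : A = \bigcap_k \bigcup_n [set w | k%:R < birkhoff S f n w].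
  apply/seteqP; split => w /=.
    by move=> Aw k _; have [n Hn] := Aw k%:R; exists n.
  move=> Aw B; have [n _ Hn] := Aw (Num.truncn `|B|).+1 I.
  exists n; apply: le_lt_trans Hn.
  exact: le_trans (ler_norm _) (ltW (truncnS_gt _)).
have mA : measurable A.
  rewrite Aeq; apply: bigcapT_measurable => k; apply: bigcupT_measurable => n.
  rewrite -[X in measurable X]setTI; apply: measurable_fun_ltr => //.
  exact: intg_measurable (intg_birkhoff n If).
have SA : S @^-1` A = A.
  apply/seteqP; split => w /= Aw B.
    have [n Hn] := Aw (B - f w); exists n.+1; rewrite birkhoffS; lra.
  (* The maximum with 0 excludes the empty sum, so that a first term can be removed. *)
  have [[|n] Hn] := Aw (Num.max 0 (B + f w)).
    by move: Hn; rewrite birkhoff0 gt_max ltxx.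
  exists n; move: Hn; rewrite birkhoffS gt_max => /andP[_ Hn]; lra.
have [PA0|PA1] := erg mA SA.
  exists A; split => //; rewrite -AC => w /=; exact: contrapT.
exfalso; move: f0; apply/negP; rewrite -leNgt.
apply: unbounded_birkhoff_ge0 => //.
exists (~` A); split => //; first exact: measurableC.
by rewrite probability_setC ?PA1 ?subee.
Qed.

(** Subtracting slightly more than the mean from [f], and likewise from [- f], leaves functions of
    negative mean, whose sums are bounded above. The slacks 1 / (k + 1) involve only countably many
    null sets. *)
Lemma birkhoff_ergodic f : intg P f -> \forall w \ae P, forall e, 0 < e ->
  exists B, forall n, `|birkhoff S f n w - n%:R * \int[P]_x f x| <= e * n%:R + B.
Proof.
move=> If.
set m := \int[P]_x f x.
have bE (s c : R) n w : birkhoff S (fun x => s * f x - c) n w = s * birkhoff S f n w - n%:R * c.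
  by rewrite /birkhoff sumrB -mulr_sumr sumr_const card_ord mulr_natl.
have step k : \forall w \ae P, exists B, forall n,
    `|birkhoff S f n w - n%:R * m| <= k.+1%:R^-1 * n%:R + B.
  have H (s : R) : s * m - (s * m + k.+1%:R^-1) < 0.
    by rewrite opprD addrA subrr sub0r oppr_lt0 invr_gt0.
  have Hs (s : R) : \forall w \ae P, exists B, forall n,
      birkhoff S (fun x => s * f x - (s * m + k.+1%:R^-1)) n w <= B.
    apply: birkhoff_bounded_above.
      apply: intgB; [exact: intgZ|exact: intg_cst].
    rewrite (RintB (intgZ s If) (intg_cst P _)) RintZ// Rint_cst; exact: H.
  move: (Hs 1) (Hs (-1)); apply: filterS2 => w [B1 H1] [B2 H2].
  exists (Num.max B1 B2) => n; move: (H1 n) (H2 n); rewrite !bE.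
  have [lB1 lB2] : B1 <= Num.max B1 B2 /\ B2 <= Num.max B1 B2.
    by rewrite !le_max !lexx orbT.
  rewrite ler_norml.
  by move: (k.+1%:R^-1) (birkhoff S f n w) (n%:R) => c X N {H1 H2} H1 H2; lra.
have := @ae_foralln _ _ _ P _ step; apply: filterS => w Hw e e0.
have [B HB] := Hw (Num.truncn e^-1).
exists B => n; apply: (le_trans (HB n)); rewrite lerD2r ler_wpM2r//.
rewrite -[leRHS]invrK lef_pV2 ?posrE ?invr_gt0//.
exact: ltW (truncnS_gt _).
Qed.

End Ergodic.

(** * Quenched walk and passage times *)

Section Walk.
Context {T : Type} {R : realType}.
Variables (Tf Ti : T -> T) (pp pm : T -> R).
Hypotheses (TfK : cancel Tf Ti) (TiK : cancel Ti Tf).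
Hypotheses (pp0 : forall x, 0 <= pp x) (pm0 : forall x, 0 <= pm x).
Hypothesis pp_pm : forall x, pp x + pm x = 1.

(** The expectation of [g] at time n for the walk from 0. A step shifts the environment and [g]
    instead of the starting point, so that inductions run over environments. *)
Fixpoint walk_expect n (g : int -> R) (w : T) : R :=
  if n is n'.+1 then pp w * walk_expect n' (fun z => g (z + 1)) (Tf w)
                   + pm w * walk_expect n' (fun z => g (z - 1)) (Ti w)
  else g 0.

Lemma walk_expect_le n (g h : int -> R) w :
  (forall z, (`|z| <= n)%N -> g z <= h z) -> walk_expect n g w <= walk_expect n h w.
Proof.
elim: n g h w => [|n IH] g h w gh /=; first exact: gh.
by apply: lerD; apply: ler_wpM2l => //; apply: IH => z zn; apply: gh; lia.
Qed.

Lemma walk_expectZ n (c : R) g w :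
  walk_expect n (fun z => c * g z) w = c * walk_expect n g w.
Proof. by elim: n g w => [|n IH] g w //=; rewrite !IH; ring. Qed.

Lemma walk_expect_cst n (c : R) w : walk_expect n (fun=> c) w = c.
Proof. by elim: n w => [|n IH] w //=; rewrite !IH -mulrDl pp_pm mul1r. Qed.

Lemma walk_expect_sum n (I : Type) (s : seq I) (g : I -> int -> R) w :
  walk_expect n (fun z => \sum_(i <- s) g i z) w = \sum_(i <- s) walk_expect n (g i) w.
Proof.
elim: n g w => [|n IH] g w //=.
by rewrite !IH !mulr_sumr -big_split.
Qed.

Lemma Tpow_add1 x w : Tpow Tf Ti (x + 1) w = Tf (Tpow Tf Ti x w).
Proof.
case: x => [n|n]; first by rewrite -PoszD addn1.
case: n => [|n]; first by rewrite /= TiK.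
by rewrite (_ : Negz n.+1 + 1 = Negz n) /= ?TiK//; lia.
Qed.

Lemma Tpow_sub1 x w : Tpow Tf Ti (x - 1) w = Ti (Tpow Tf Ti x w).
Proof. by rewrite -[in RHS](subrK 1 x) Tpow_add1 TfK. Qed.

Lemma sum_tupleS n (F : seq bool -> R) (Q : pred (seq bool)) :
  \sum_(s : n.+1.-tuple bool | Q s) F s =
  \sum_(s : n.-tuple bool | Q (true :: s)) F (true :: s) +
  \sum_(s : n.-tuple bool | Q (false :: s)) F (false :: s).
Proof.
rewrite big_mkcond /=.
rewrite (reindex (fun p : bool * n.-tuple bool => [tuple of p.1 :: p.2])) /=; last first.
  exists (fun s => (thead s, [tuple of behead s])) => /=.
    by move=> [b s] _; congr pair => //; apply/val_inj.
  by move=> s _; rewrite [RHS]tuple_eta.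
rewrite -(pair_bigA _ (fun (b : bool) (s : n.-tuple bool) => if Q (b :: s) then F (b :: s) else 0)) /=.
by rewrite big_bool /= -!big_mkcond.
Qed.

Lemma sum_walk_prob n (w : T) x (Q : pred int) :
  \sum_(s : n.-tuple bool | Q (walk_end x s)) walk_prob Tf Ti pp pm w x s =
  walk_expect n (fun z => (Q (x + z))%:R) (Tpow Tf Ti x w).
Proof.
elim: n x => [|n IH] x /=.
  rewrite big_mkcond (big_pred1 [tuple]) => [|s]; last by rewrite [s]tuple0 /= eqxx.
  by rewrite /= addr0; case: (Q x).
rewrite (@sum_tupleS n (walk_prob Tf Ti pp pm w x) (fun s => Q (walk_end x s))) /=.
rewrite -!mulr_sumr !IH Tpow_add1 Tpow_sub1.
by congr (_ * walk_expect _ _ _ + _ * walk_expect _ _ _); apply/funext => z;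
  congr (Q _)%:R; ring.
Qed.

Lemma quenched_probE n (w : T) (A : set R) :
  quenched_prob Tf Ti pp pm w n A =
  walk_expect n (fun z => (`[< A (z%:~R / n%:R) >])%:R) w.
Proof.
rewrite /quenched_prob (@sum_walk_prob n w 0 (fun z => `[< A (z%:~R / n%:R) >])).
by congr (walk_expect _ _ _); apply/funext => z; rewrite add0r.
Qed.

(* Probability that the walk started at 0 first visits j at time n. *)
Fixpoint hit n (w : T) (j : nat) : R :=
  match n, j with
  | 0, 0 => 1
  | 0, _ => 0
  | n'.+1, 0 => 0
  | n'.+1, j'.+1 => pp w * hit n' (Tf w) j' + pm w * hit n' (Ti w) j'.+2
  end.

Lemma hit_ge0 n w j : 0 <= hit n w j.
Proof.
by elim: n w j => [|n IH] w [|j] //=; rewrite addr_ge0// mulr_ge0.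
Qed.

Lemma hit_le1 n w j : hit n w j <= 1.
Proof.
elim: n w j => [|n IH] w [|j] //=.
by rewrite -(pp_pm w) lerD// -[leRHS]mulr1 ler_wpM2l.
Qed.

(** A nearest-neighbour walk visits j before j + l; the convolution is the Markov property at the
    first visit of j, where the environment is [iter j Tf w]. *)
Lemma hitD n w j l :
  hit n w (j + l) = \sum_(k < n.+1) hit k w j * hit (n - k) (iter j Tf w) l.
Proof.
elim: n w j => [|n IH] w [|j].
- by rewrite big_ord1 /= mul1r.
- by rewrite big_ord1 /= mul0r.
- rewrite add0n big_ord_recl subn0 mul1r big1 ?addr0// => i _.
  by rewrite /= mul0r.
rewrite big_ord_recl /= mul0r add0r -!addSn !IH !mulr_sumr -big_split /=.
apply: eq_bigr => k _; rewrite /bump /= add1n subSS.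
by rewrite -!iterS !iterSr TiK; ring.
Qed.

Lemma walk_expect_ge1 n g w : (forall z, (`|z| <= n)%N -> 1 <= g z) ->
  1 <= walk_expect n g w.
Proof.
by move=> g1; rewrite -[leLHS](walk_expect_cst n 1 w); exact: walk_expect_le.
Qed.

(** First visits at distinct times are disjoint events, and a walk that is at j at a time k >= n - L
    is still within L of j at time n. *)
Lemma sum_hit_le_walk_expect n L g w j : (forall z, 0 <= g z) ->
  (forall z, (`|z - j%:Z| <= L)%N -> 1 <= g z) ->
  \sum_(k < n.+1 | (n <= k + L)%N) hit k w j <= walk_expect n g w.
Proof.
elim: n g w j => [|n IH] g w j g0 g1.
  rewrite big_mkcond big_ord1 /=; case: j g1 => [|j] g1 //.
  exact: g1.
case: j g1 => [|j] g1.
  rewrite big_mkcond big_ord_recl /= big1 ?addr0; last first.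
    by move=> i _; case: ifP.
  case: ifP => [nL|_].
    apply: (@walk_expect_ge1 n.+1) => z zn; apply: g1; lia.
  rewrite -[leLHS](walk_expect_cst n.+1 0 w); exact: (@walk_expect_le n.+1).
rewrite big_mkcond big_ord_recl /= if_same add0r -big_mkcond /=.
rewrite (eq_bigl (fun k : 'I_n.+1 => n <= k + L)%N); last by move=> k; rewrite /bump /=; lia.
rewrite big_split /= -!mulr_sumr.
by apply: lerD; apply: ler_wpM2l => //; apply: IH => // z zL; apply: g1; lia.
Qed.

End Walk.

(** * Elementary inequalities for exponentials, sums and polynomials *)

Section RealLemmas.
Context {R : realType}.
Implicit Types x y r a b eta : R.

(** From e^x (1 - x) <= 1, the left side is at most 2 / (1 - x^2), and (1 - x^2) (1 + 2 x^2) >= 1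
    when x^2 <= 1/4. *)
Lemma expR_add_expRN_le x : `|x| <= 2^-1 -> expR x + expR (- x) <= 2 * expR (2 * x ^+ 2).
Proof.
rewrite ler_norml => /andP[x1 x2].
have H y : `|y| <= 2^-1 -> expR y * (1 - y) <= 1.
  move=> _; have := expR_ge1Dx (- y); rewrite -[X in _ -> _ <= X](expRxMexpNx_1 y).
  by move=> ?; rewrite ler_wpM2l ?expR_ge0.
have Hx : expR x * (1 - x) <= 1 by apply: H; rewrite ler_norml x1 x2.
have Hx' : expR (- x) * (1 + x) <= 1.
  by rewrite -[x in _ + x]opprK; apply: H; rewrite ler_norml; lra.
have := expR_ge1Dx (2 * x ^+ 2).
suff : expR x + expR (- x) <= 2 * (1 + 2 * x ^+ 2) by lra.
move: Hx Hx' (expR_gt0 x) (expR_gt0 (- x)); move: (expR x) (expR (-x)) => u v Hu Hv u0 v0.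
have E : (u + v) * (1 - x ^+ 2) <= 2.
  have : u * (1 - x) * (1 + x) + v * (1 + x) * (1 - x) <= 1 * (1 + x) + 1 * (1 - x).
    by apply: lerD; apply: ler_wpM2r => //; lra.
  by rewrite (_ : _ + _ = (u + v) * (1 - x ^+ 2)); [lra|ring].
have x0 : 0 <= x ^+ 2 <= 4^-1 by nra.
have : (u + v) * ((1 - x ^+ 2) * (1 + 2 * x ^+ 2)) <= 2 * (1 + 2 * x ^+ 2).
  by rewrite mulrA ler_wpM2r//; lra.
move: (x ^+ 2) x0 => t x0; apply: le_trans.
by apply: ler_peMr; [lra|nra].
Qed.

(** Twice each side is a double sum over i and j; once symmetrized, the two are compared term by
    term. *)
Lemma sum_mul_le_sqr n (a x y : 'I_n -> R) kappa : (forall i, 0 <= a i) ->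
  (forall i j, x i * y j + x j * y i <= 2 * kappa) ->
  (\sum_i a i * x i) * (\sum_i a i * y i) <= kappa * (\sum_i a i) ^+ 2.
Proof.
move=> a0 xy.
suff : 2 * ((\sum_i a i * x i) * (\sum_i a i * y i)) <= 2 * (kappa * (\sum_i a i) ^+ 2).
  by rewrite ler_pM2l.
have -> : 2 * ((\sum_i a i * x i) * (\sum_i a i * y i)) =
    \sum_i \sum_j a i * a j * (x i * y j + x j * y i).
  rewrite mulr_natl mulr2n [X in _ + X]mulrC !big_distrlr -big_split.
  apply: eq_bigr => i _; rewrite -big_split; apply: eq_bigr => j _ /=; ring.
have -> : 2 * (kappa * (\sum_i a i) ^+ 2) = \sum_i \sum_j a i * a j * (2 * kappa).
  rewrite expr2 big_distrlr mulrA mulr_sumr; apply: eq_bigr => i _.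
  by rewrite mulr_sumr; apply: eq_bigr => j _ /=; ring.
by apply: ler_sum => i _; apply: ler_sum => j _; rewrite ler_wpM2l ?mulr_ge0.
Qed.

(* Chernoff: outside the window [a, b] one of the two tilts dominates. *)
Lemma horner_window (p : {poly R}) M r eta a b : (forall i, 0 <= p`_i) ->
  0 <= eta -> (size p <= M)%N ->
  p.[expR (- r)] <= \sum_(i < M | a <= i%:R <= b) p`_i * expR (- r) ^+ i
    + expR (- (eta * b)) * p.[expR (- (r - eta))]
    + expR (eta * a) * p.[expR (- (r + eta))].
Proof.
move=> p0 eta0 sM; rewrite !(horner_coef_wide _ sM) !mulr_sumr.
rewrite [X in _ <= X + _ + _]big_mkcond -!big_split; apply: ler_sum => i _ /=.
rewrite -!expRM_natr !(mulrCA _ p`_i) -!expRD.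
have t1 := mulr_ge0 (p0 i) (expR_ge0 (- (eta * b) + - (r - eta) * i%:R)).
have t2 := mulr_ge0 (p0 i) (expR_ge0 (eta * a + - (r + eta) * i%:R)).
case: ifP => [|/negbT]; first by lra.
rewrite negb_and -!ltNge add0r => /orP[ia|bi].
  suff : p`_i * expR (- r * i%:R) <= p`_i * expR (eta * a + - (r + eta) * i%:R) by lra.
  by rewrite ler_wpM2l// ler_expR; nra.
suff : p`_i * expR (- r * i%:R) <= p`_i * expR (- (eta * b) + - (r - eta) * i%:R) by lra.
by rewrite ler_wpM2l// ler_expR; nra.
Qed.

End RealLemmas.

(** * Generating functions of truncated passage times *)

Section GenFun.
Context {T : Type} {R : realType}.
Variables (Tf Ti : T -> T) (pp pm : T -> R).
Hypotheses (TfK : cancel Tf Ti) (TiK : cancel Ti Tf).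
Hypotheses (pp0 : forall x, 0 < pp x) (pm0 : forall x, 0 < pm x).
Hypothesis pp_pm : forall x, pp x + pm x = 1.
Let pp0' x : 0 <= pp x := ltW (pp0 x).
Let pm0' x : 0 <= pm x := ltW (pm0 x).
Local Notation hit := (hit Tf Ti pp pm).
Local Notation hit_ge0 := (hit_ge0 Tf Ti pp0' pm0').
Implicit Types (N m n k : nat) (r s eta delta v alpha : R) (w : T).

(* E[e^(-r H); H <= N] for the passage time H from 0 to 1. *)
Definition gf N r w := \sum_(k < N.+1) hit k w 1 * expR (- r) ^+ k.

Definition hit_poly N w : {poly R} := \poly_(k < N.+1) hit k w 1.

(** The k-th coefficient is the probability that m successive unit passages, each of at most N
    steps, take k steps in all. *)
Definition hit_prod N m w : {poly R} := \prod_(i < m) hit_poly N (iter i Tf w).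

Lemma horner_hit_poly N r w : (hit_poly N w).[expR (- r)] = gf N r w.
Proof. by rewrite horner_poly. Qed.

Lemma hit1 w : hit 1 w 1 = pp w.
Proof. by rewrite /= mulr1 mulr0 addr0. Qed.

(** The walk goes to -1, returns to 0 at once, and only then makes its passage. *)
Lemma hitSS k w : pm w * pp (Ti w) * hit k w 1 <= hit k.+2 w 1.
Proof.
rewrite /= mulr0 TiK add0r.
have h : 0 <= pp w * (if k is 0 then 0 else 0) by case: k => [|k]; rewrite mulr0.
rewrite mulrDr -mulrA.
have := mulr_ge0 (pm0' w) (mulr_ge0 (pm0' (Ti w)) (hit_ge0 k (Ti (Ti w)) 3)).
by lra.
Qed.

Lemma hit_term_ge0 k r w : 0 <= hit k w 1 * expR (- r) ^+ k.
Proof. by rewrite mulr_ge0 ?hit_ge0// exprn_ge0// expR_ge0. Qed.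

Lemma gf_ge_term N k r w : (k <= N)%N -> hit k w 1 * expR (- r) ^+ k <= gf N r w.
Proof.
move=> kN; rewrite /gf (bigD1 (inord k)) //= inordK ?ltnS// lerDl.
by apply: sumr_ge0 => i _; exact: hit_term_ge0.
Qed.

Lemma gf_ge N r w : (0 < N)%N -> pp w * expR (- r) <= gf N r w.
Proof. by move=> N0; have := @gf_ge_term N 1 r w N0; rewrite hit1 expr1. Qed.

Lemma gf_gt0 N r w : (0 < N)%N -> 0 < gf N r w.
Proof.
by move=> N0; apply: lt_le_trans (gf_ge r w N0); rewrite mulr_gt0// expR_gt0.
Qed.

Lemma gf_nd r w : {homo (fun N => gf N r w) : M N / (M <= N)%N >-> M <= N}.
Proof.
move=> M N MN /=; rewrite /gf
  (big_ord_widen _ (fun k => hit k w 1 * expR (- r) ^+ k) (MN : (M.+1 <= N.+1)%N)).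
by rewrite big_mkcond; apply: ler_sum => i _; case: ifP => // _; exact: hit_term_ge0.
Qed.

Lemma gf_le N r w : gf N r w <= N.+1%:R * expR (N%:R * `|r|).
Proof.
rewrite -[N.+1]card_ord -sum1_card natr_sum mulr_suml.
apply: ler_sum => i _; rewrite mul1r -[leRHS]mul1r.
rewrite ler_pM ?hit_ge0 ?hit_le1 ?exprn_ge0 ?expR_ge0//.
rewrite -expRM_natl ler_expR; have := ler_norm (- r); rewrite normrN => rr.
have iN : i%:R <= N%:R :> R by rewrite ler_nat -ltnS.
have := ler0n R i; have := normr_ge0 r; nra.
Qed.

Lemma gf_lipschitz N r s w : gf N s w <= expR (N%:R * `|r - s|) * gf N r w.
Proof.
rewrite mulr_sumr; apply: ler_sum => i _; rewrite mulrCA ler_wpM2l ?hit_ge0//.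
rewrite -!expRM_natl -expRD ler_expR; have rr := ler_norm (r - s).
have iN : i%:R <= N%:R :> R by rewrite ler_nat -ltnS.
have := ler0n R i; have := normr_ge0 (r - s); nra.
Qed.

(** The symmetrized cross terms of the product are e^u + e^(-u) with |u| <= N eta, because exponents
    lie in [0, N]. This upper bound on the second difference of [ln (gf N r w)] in r replaces
    differentiability. *)
Lemma gf_log_semiconcave N r eta w : 0 <= eta -> N%:R * eta <= 2^-1 ->
  gf N (r - eta) w * gf N (r + eta) w <=
  expR (2 * (N%:R * eta) ^+ 2) * gf N r w ^+ 2.
Proof.
move=> eta0 Neta; rewrite /gf.
have E s : \sum_(k < N.+1) hit k w 1 * expR (- (r + s)) ^+ k =
    \sum_(k < N.+1) (hit k w 1 * expR (- r) ^+ k) * expR (- (s * k%:R)).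
  apply: eq_bigr => k _; rewrite -mulrA; congr (_ * _).
  by rewrite -!expRM_natr -expRD; congr expR; ring.
rewrite (E (- eta)) (E eta); apply: sum_mul_le_sqr => [k|i j]; first exact: hit_term_ge0.
rewrite -!expRD; set u := (X in expR X + _).
rewrite (_ : - (- eta * j%:R) + _ = - u); last by rewrite /u; ring.
have iN : i%:R <= N%:R :> R by rewrite ler_nat -ltnS.
have jN : j%:R <= N%:R :> R by rewrite ler_nat -ltnS.
have uE : u = eta * (i%:R - j%:R) by rewrite /u; ring.
have uN : `|u| <= N%:R * eta.
  rewrite uE normrM (ger0_norm eta0) mulrC ler_wpM2r// ler_norml.
  have := ler0n R i; have := ler0n R j; lra.
apply: le_trans (expR_add_expRN_le (le_trans uN Neta)) _.
rewrite ler_pM2l// ler_expR ler_pM2l// -[u ^+ 2]real_normK ?num_real//.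
by rewrite lerXn2r ?nnegrE// (le_trans _ uN).
Qed.

(* First-step decomposition of the passage from 0 to 1. *)
Lemma gf_step N r w : (0 < N)%N ->
  pp w * expR (- r) + pm w * expR (- r) * (gf N r (Ti w) * gf N r w) <=
  gf (N + N).+1 r w.
Proof.
move=> N0; rewrite [leRHS]/gf [leRHS]big_ord_recl /= mul0r add0r.
have E (i : 'I_(N + N).+1) : hit i.+1 w 1 * expR (- r) ^+ i.+1 =
   pp w * expR (- r) * (hit i (Tf w) 0 * expR (- r) ^+ i) +
   pm w * expR (- r) * (hit i (Ti w) (1 + 1) * expR (- r) ^+ i).
  by rewrite /= exprS; ring.
rewrite (eq_bigr _ (fun i _ => E i)) big_split -!mulr_sumr; apply: lerD.
  rewrite big_ord_recl /= mul1r expr0 big1 ?addr0 ?mulr1//.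
  by move=> i _; rewrite /= mul0r.
rewrite ler_wpM2l ?mulr_ge0 ?expR_ge0//.
rewrite -!horner_hit_poly -hornerM.
rewrite (@horner_coef_wide _ (N + N).+1); last first.
  have := size_polyMleq (hit_poly N (Ti w)) (hit_poly N w).
  have s1 : (size (hit_poly N (Ti w)) <= N.+1)%N := size_poly _ _.
  have s2 : (size (hit_poly N w) <= N.+1)%N := size_poly _ _.
  move=> /leq_trans; apply; have := leq_add s1 s2.
  by rewrite addSn addnS; case: (_ + _)%N.
apply: ler_sum => i _; rewrite ler_wpM2r ?exprn_ge0 ?expR_ge0//.
(* From [Ti w] a target at distance 2 is reached by two unit passages, in the environments [Ti w]
   and [w]; truncation only lowers the convolution. *)
rewrite (hitD _ _ TiK) coefM; apply: ler_sum => j _; rewrite !coef_poly /= TiK.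
by apply: ler_pM => //; try case: ifP => // _; exact: hit_ge0.
Qed.

Lemma hit_prodS N m w : hit_prod N m.+1 w = hit_poly N w * hit_prod N m (Tf w).
Proof.
rewrite /hit_prod big_ord_recl /=; congr (_ * _).
by apply: eq_bigr => i _; rewrite -iterS iterSr.
Qed.

(** Without truncation the coefficients would equal [hit k w m] by [hitD]; truncation drops
    nonnegative terms. *)
Lemma coef_hit_prod N m w k : 0 <= (hit_prod N m w)`_k <= hit k w m.
Proof.
elim: m w k => [|m IH] w k.
  rewrite /hit_prod big_ord0 coef1; case: k => [|k] /=; first by rewrite ler01 lexx.
  by rewrite lexx.
have c0 i : 0 <= (hit_poly N w)`_i <= hit i w 1.
  by rewrite coef_poly; case: ifP; rewrite ?lexx hit_ge0.
rewrite hit_prodS coefM (hitD _ _ TiK k w 1 m); apply/andP; split.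
  apply: sumr_ge0 => i _; apply: mulr_ge0; first by case/andP: (c0 i).
  by case/andP: (IH (Tf w) (k - i)%N).
apply: ler_sum => i _; have /andP[? ?] := c0 i.
by have /andP[? ?] := IH (Tf w) (k - i)%N; exact: ler_pM.
Qed.

Lemma horner_hit_prod N m w r : (0 < N)%N ->
  (hit_prod N m w).[expR (- r)] = expR (birkhoff Tf (fun w => ln (gf N r w)) m w).
Proof.
move=> N0; elim: m w => [|m IH] w.
  by rewrite /hit_prod big_ord0 birkhoff0 expR0 hornerC.
by rewrite hit_prodS hornerM IH birkhoffS expRD horner_hit_poly lnK ?posrE ?gf_gt0.
Qed.

(** Here [g] stands for the mean of [ln (gf N s)] and u for the mean tilted passage time. The bounds
    at r - eta and r + eta make the tilted mass of [hit_prod] outside |k - m u| <= m delta at most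
    half of the total for large m. *)
Lemma hit_window N r u delta eta (g : R -> R) w : (0 < N)%N ->
  0 < eta <= 1 -> 0 < delta ->
  (forall s, s \in [:: r; r - eta; r + eta] -> forall e : R, 0 < e ->
    exists B : R, forall m, `|birkhoff Tf (fun w => ln (gf N s w)) m w - m%:R * g s| <= e * m%:R + B) ->
  g (r - eta) <= g r + eta * u + eta * delta / 2 ->
  g (r + eta) <= g r - eta * u + eta * delta / 2 ->
  exists (B : R) m0, forall m n, (m0 <= m)%N -> m%:R * (u + delta) <= n%:R ->
    expR (m%:R * (g r + r * u - (`|r| + 1) * delta) - B) <=
    \sum_(k < n.+1 | m%:R * (u - delta) <= k%:R) hit k w m.
Proof.
move=> N0 /andP[eta0 eta1] delta0 HB gm gp.
(* Outside the window the tilts gain m eta delta / 2 = 4 e m, against 2 e m of ergodic errors; the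
   remaining 2 e m absorbs the constants once B + 1 <= e m. *)
pose e : R := eta * delta / 8.
have e0 : 0 < e by rewrite /e divr_gt0 ?mulr_gt0.
have [B0 HB0] := HB r (mem_head _ _) e e0.
have [B1 HB1] : exists B : R, forall m,
    `|birkhoff Tf (fun w => ln (gf N (r - eta) w)) m w - m%:R * g (r - eta)| <= e * m%:R + B.
  by apply: HB e0; rewrite !inE eqxx orbT.
have [B2 HB2] : exists B : R, forall m,
    `|birkhoff Tf (fun w => ln (gf N (r + eta) w)) m w - m%:R * g (r + eta)| <= e * m%:R + B.
  by apply: HB e0; rewrite !inE eqxx !orbT.
pose B : R := `|B0| + `|B1| + `|B2|.
have [B0B [B1B B2B]] : B0 <= B /\ B1 <= B /\ B2 <= B.
  have := ler_norm B0; have := ler_norm B1; have := ler_norm B2.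
  have := normr_ge0 B0; have := normr_ge0 B1; have := normr_ge0 B2; rewrite /B; lra.
exists (B + 1), (Num.truncn ((B + 1) / e)).+1 => m n m0m mn.
have me : B + 1 <= e * m%:R.
  rewrite mulrC -ler_pdivrMr//; apply: ltW; apply: lt_le_trans (truncnS_gt _) _.
  by rewrite ler_nat.
set a := m%:R * (u - delta); set b := m%:R * (u + delta).
set p := hit_prod N m w.
pose M := (n.+1 + size p)%N.
have pc k := coef_hit_prod N m w k.
have p0 k : 0 <= p`_k by case/andP: (pc k).
have := @horner_window _ p M r eta a b p0 (ltW eta0) (leq_addl _ _).
rewrite !horner_hit_prod// -!expRD.
move: (HB0 m) (HB1 m) (HB2 m).
move: (birkhoff _ _ _ _) (birkhoff _ _ _ _) (birkhoff _ _ _ _) => X2 X1 X0 H0 H1 H2.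
set W := \sum_(i < M | _) _ => HW.
pose Y := m%:R * g r - e * m%:R - B.
have m_ge0 : 0 <= m%:R :> R by [].
have mgm := ler_wpM2l m_ge0 gm; have mgp := ler_wpM2l m_ge0 gp.
have emE : e * m%:R = m%:R * (eta * delta) / 8 by rewrite /e; ring.
move: H0 H1 H2; rewrite !ler_distl => /andP[H0 _] /andP[_ H1] /andP[_ H2].
have YX : Y <= X0 by rewrite /Y; lra.
have X1Y : - (eta * b) + X1 <= Y - 2.
  have -> : eta * b = m%:R * (eta * u) + m%:R * (eta * delta) by rewrite /b; ring.
  rewrite /Y; lra.
have X2Y : eta * a + X2 <= Y - 2.
  have -> : eta * a = m%:R * (eta * u) - m%:R * (eta * delta) by rewrite /a; ring.
  rewrite /Y; lra.
(* Each outer tilt takes at most a quarter of e^Y, which leaves [W] at least e^Y / 2 >= e^(Y -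
   1). *)
have e2 : expR (Y - 2) <= 4^-1 * expR Y.
  rewrite expRB mulrC ler_wpM2r ?expR_ge0// lef_pV2 ?posrE ?expR_gt0//.
  have := expR_ge1Dx (1 : R).
  have -> : expR 2 = expR 1 * expR 1 :> R by rewrite -expRD; congr expR; ring.
  by nra.
have e1 : expR (Y - 1) <= 2^-1 * expR Y.
  rewrite expRB mulrC ler_wpM2r ?expR_ge0// lef_pV2 ?posrE ?expR_gt0//.
  exact: expR_ge1Dx.
have WY : expR (Y - 1) <= W.
  have E0 : expR Y <= expR X0 by rewrite ler_expR.
  have E1 : expR (- (eta * b) + X1) <= expR (Y - 2) by rewrite ler_expR.
  have E2 : expR (eta * a + X2) <= expR (Y - 2) by rewrite ler_expR.
  lra.
(* Inside the window the tilt e^(-r k) equals e^(-r u m) up to a factor e^(|r| delta m). *)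
have WS : W <= expR (- (r * u * m%:R) + `|r| * delta * m%:R) *
    \sum_(k < n.+1 | a <= k%:R) hit k w m.
  rewrite (big_ord_widen_cond M (fun k : nat => a <= k%:R) (fun k => hit k w m)) ?leq_addr//.
  rewrite /W mulr_sumr [leRHS]big_mkcond [leLHS]big_mkcond /=; apply: ler_sum => i _.
  case: ifP => [/andP[ai ib]|_]; last first.
    by case: ifP => // _; rewrite mulr_ge0 ?expR_ge0 ?hit_ge0.
  rewrite ai ltnS -(ler_nat R) (le_trans ib mn) /= mulrC.
  have /andP[_ pi] := pc i.
  rewrite ler_pM ?exprn_ge0 ?expR_ge0// -expRM_natr ler_expR.
  have : - r * (i%:R - u * m%:R) <= `|r| * (delta * m%:R).
    apply: le_trans (ler_norm _) _; rewrite normrM normrN ler_wpM2l//.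
    by rewrite ler_norml; move: ai ib; rewrite /a /b; lra.
  lra.
rewrite -(ler_pM2l (expR_gt0 (- (r * u * m%:R) + `|r| * delta * m%:R))).
apply: le_trans WS; apply: le_trans WY; rewrite -expRD ler_expR /Y.
have : m%:R * (eta * delta) <= m%:R * delta.
  by rewrite ler_wpM2l// ger_pMl.
have : 0 <= m%:R * (eta * delta) by rewrite !mulr_ge0// ltW.
lra.
Qed.

(** The walk is made to reach a site m close to n v shortly before time n; in the time that is left
    it cannot go far from m. *)
Lemma quenched_prob_lower N r v alpha (g : R -> R) w : (0 < N)%N -> 0 < v < 1 ->
  (forall delta, 0 < delta -> exists2 eta, 0 < eta <= 1 &
    [/\ (forall s, s \in [:: r; r - eta; r + eta] -> forall e : R, 0 < e -> exists B : R, forall m,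
        `|birkhoff Tf (fun w => ln (gf N s w)) m w - m%:R * g s| <= e * m%:R + B),
      g (r - eta) <= g r + eta * v^-1 + eta * delta / 2 &
      g (r + eta) <= g r - eta * v^-1 + eta * delta / 2]) ->
  alpha < v * g r + r ->
  forall eps : R, 0 < eps -> exists n0, forall n, (n0 <= n)%N ->
  expR (n%:R * alpha) <=
    quenched_prob Tf Ti pp pm w n [set x | `|x - v| < eps].
Proof.
move=> N0 /andP[v0 v1] H; set psi : R := v * g r + r => alpha_psi eps eps0.
have trunc_lt (x : R) k : (Num.truncn x < k)%N -> x <= k%:R.
  by move=> xk; apply: ltW; apply: lt_le_trans (truncnS_gt _) _; rewrite ler_nat.
have lt3 a b c n : (a + b + c < n)%N -> [/\ a < n, b < n & c < n]%N.
  by move=> H3; split; clear -H3; lia.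
have u1 : 1 < v^-1 by rewrite invf_gt1.
set u : R := v^-1 in H u1; have uv : u * v = 1 by rewrite mulVf// gt_eqF.
have [psi0 r0] := (normr_ge0 psi, normr_ge0 r).
have psiu0 : 0 <= `|psi| * u by rewrite mulr_ge0//; lra.
(* [K] collects the losses proportional to n delta, which then cost at most half of [psi - alpha].
   The bound eps / 6 keeps the 3 delta n of the final distance below n eps / 2. *)
pose K : R := `|psi| * u + `|r| + 1; have K0 : 0 < K by rewrite /K; lra.
pose delta : R := Num.min 1 (Num.min (eps / 6) ((psi - alpha) / (2 * K))).
have d0 : 0 < delta.
  by rewrite !lt_min ltr01 !divr_gt0 ?subr_gt0// mulr_gt0.
have d1 : delta <= 1 by rewrite ge_min lexx.
have deps : delta <= eps / 6 by rewrite !ge_min lexx !orbT.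
have dK : delta * (2 * K) <= psi - alpha.
  by rewrite -ler_pdivlMr ?mulr_gt0// !ge_min lexx !orbT.
have [eta eta01 [HB gm gp]] := H delta d0.
have [B [m0 HW]] := hit_window N0 eta01 d0 HB gm gp.
pose c : R := u + delta; have c0 : 0 < c by rewrite /c; lra.
(* [n1] ensures m >= m0, [n2] absorbs the constants in the exponent, and [n3] those in the final
   distance. *)
pose n1 := Num.truncn (c * m0.+1%:R).
pose n2 := Num.truncn ((2 * (`|psi| * u) + B) * 2 / (psi - alpha)).
pose n3 := Num.truncn ((u + 4) * 2 / eps).
exists (n1 + n2 + n3).+1 => n /lt3[/trunc_lt Hn1 /trunc_lt Hn2 /trunc_lt Hn3].
have n_gt0 : 0 < n%:R :> R by apply: lt_le_trans Hn1; rewrite mulr_gt0.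
rewrite ler_pdivrMr ?subr_gt0// in Hn2; rewrite ler_pdivrMr// in Hn3.
(* m is slightly below n v, so that the passage window, which ends at m (u + delta), ends before
   n. *)
pose m := Num.truncn (n%:R / c).
have /andP[mn mn1] : m%:R <= n%:R / c < m.+1%:R by apply: truncn_itv; rewrite divr_ge0// ltW.
rewrite ler_pdivlMr// in mn; rewrite ltr_pdivrMr// -natr1 in mn1.
have m0m : (m0 <= m)%N.
  rewrite -ltnS -(ltr_nat R) -[m.+1%:R]natr1 -(ltr_pM2r c0); apply: le_lt_trans mn1.
  by apply: le_trans Hn1; rewrite mulrC ler_wpM2l ?ler_nat// ltW.
have := HW m n m0m mn.
(* Passage times k >= m (u - delta) satisfy n <= k + L, because n < (m + 1) c. *)
set L := Num.truncn (2 * delta * n%:R + c).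
have m_ge0 : 0 <= m%:R :> R by [].
have dn0 : 0 <= delta * n%:R by rewrite mulr_ge0// ltW.
have L0 : 0 <= 2 * delta * n%:R + c by lra.
have /andP[LE LE1] := truncn_itv L0; rewrite -/L in LE LE1; rewrite -[L.+1%:R]natr1 in LE1.
have mv : m%:R <= n%:R * v.
  have : m%:R * c * v <= n%:R * v by rewrite ler_wpM2r// ltW.
  have -> : m%:R * c * v = m%:R + m%:R * delta * v.
    by rewrite /c; transitivity (m%:R * (u * v) + m%:R * delta * v); [ring|rewrite uv; ring].
  by have : 0 <= m%:R * delta * v by [rewrite !mulr_ge0// ltW]; lra.
have nvn : n%:R * v <= n%:R by rewrite ger_pMr// ltW.
have nv : n%:R * v <= m%:R + 2 + delta * n%:R.
  have : n%:R * v <= (m%:R + 1) * c * v by rewrite ler_wpM2r// ltW.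
  have -> : (m%:R + 1) * c * v = m%:R + 1 + delta * (m%:R * v) + delta * v.
    by rewrite /c;
      transitivity ((m%:R + 1) * (u * v) + (m%:R + 1) * (delta * v)); [ring|rewrite uv; ring].
  have : delta * (m%:R * v) <= delta * n%:R.
    apply: ler_wpM2l; first exact: ltW.
    by apply: le_trans (le_trans mv nvn); rewrite ler_piMr// ltW.
  have : delta * v <= 1 by rewrite mulr_ile1// ltW.
  lra.
have mnv : `|m%:R - n%:R * v| <= 2 + delta * n%:R by rewrite ler_norml; lra.
move=> HS; apply: le_trans (_ : _ <= \sum_(k < n.+1 | (n <= k + L)%N) hit k w m) _.
  apply: le_trans (le_trans HS _).
    rewrite ler_expR.
    have -> : g r + r * u = psi * u.
      by transitivity (g r * (u * v) + r * u); [rewrite uv|rewrite /psi]; ring.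
    have E : m%:R * (psi * u) = n%:R * psi + psi * u * (m%:R - n%:R * v).
      by transitivity (n%:R * psi * (u * v) + psi * u * (m%:R - n%:R * v)); [ring|rewrite uv; ring].
    have : - (`|psi| * u * (2 + delta * n%:R)) <= psi * u * (m%:R - n%:R * v).
      have u0 : 0 < u by lra.
      have : `|psi * u * (m%:R - n%:R * v)| <= `|psi| * u * (2 + delta * n%:R).
        by rewrite !normrM (gtr0_norm u0) ler_wpM2l.
      by rewrite ler_norml => /andP[].
    have : m%:R * ((`|r| + 1) * delta) <= n%:R * ((`|r| + 1) * delta).
      by rewrite ler_wpM2r ?(le_trans mv nvn)// mulr_ge0 ?ltW//; lra.
    have := ler_wpM2r (ltW n_gt0) dK.
    move=> h1 h2 h3; rewrite mulrBr E; move: h1 h2 h3 Hn2; rewrite /K; clear; lra.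
  rewrite big_mkcond [leRHS]big_mkcond; apply: ler_sum => k _.
  case: ifP => ak; last by case: ifP; rewrite ?hit_ge0.
  rewrite ifT// -ltnS -(ltr_nat R) -[_.+1%:R]natr1 natrD.
  have : m%:R * delta <= n%:R * delta by rewrite ler_wpM2r ?(le_trans mv nvn)// ltW.
  by move: ak mn1 LE1; rewrite /c; lra.
rewrite (quenched_probE _ _ TfK TiK).
apply: sum_hit_le_walk_expect => // z; rewrite ?ler0n// => zL.
rewrite asboolT//=.
rewrite -(ltr_pM2l n_gt0) -[X in X * `| _ |](gtr0_norm n_gt0) -normrM mulrBr mulrC divfK ?gt_eqF//.
have zm : `|z%:~R - m%:R| <= L%:R :> R.
  by rewrite -[m%:R]/(m%:Z%:~R) -intrB -intr_norm -abszE -[L%:R]/(L%:Z%:~R) ler_int lez_nat.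
have : `|z%:~R - n%:R * v| <= L%:R + (2 + delta * n%:R).
  rewrite -[z%:~R](subrK m%:R) -addrA; apply: le_trans (ler_normD _ _) _; exact: lerD.
move=> /le_lt_trans; apply.
have := ler_wpM2r (ltW n_gt0) deps; move: LE Hn3 d1; rewrite /c; lra.
Qed.

End GenFun.

(** Monotone convergence applied to [h n - h 0]: the bound on the integrals makes the limit finite
    almost everywhere. Convergence is stated as approximation from below, ready for use in
    inequalities. *)
Lemma intg_monotone_sup (d : measure_display) (T : measurableType d) (R : realType)
  (P : probability T R) (h : nat -> T -> R) (C : R) :
  (forall n, intg P (h n)) -> (forall n x, h n x <= h n.+1 x) ->
  (forall n, \int[P]_x h n x <= C) ->
  exists f, [/\ intg P f, \int[P]_x f x <= C &
    \forall x \ae P, (forall n, h n x <= f x) /\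
      (forall e : R, 0 < e -> exists n, f x - e < h n x)].
Proof.
move=> Ih ndh hC.
have nd x : nondecreasing_seq (h ^~ x) by apply/nondecreasing_seqP => n; exact: ndh.
pose D n x := (h n x - h 0 x)%:E.
pose G x := limn (D ^~ x).
have ID n : intg P (fun x => h n x - h 0 x) by exact: intgB.
have mD n : measurable_fun setT (D n) by exact: measurable_int (ID n).
have D0 n x : (0 <= D n x)%E by rewrite lee_fin subr_ge0 nd.
have ndD x : nondecreasing_seq (D ^~ x).
  by move=> m n mn; rewrite lee_fin lerD2r nd.
have DG x : D ^~ x @ \oo --> ereal_sup (range (D ^~ x)) by exact: ereal_nondecreasing_cvgn.
have GE x : G x = ereal_sup (range (D ^~ x)) by exact/cvg_lim.
have mG : measurable_fun setT G.
  apply: (emeasurable_fun_cvg D) => // x _; rewrite GE; exact: DG.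
have G0 x : (0 <= G x)%E.
  by apply: le_trans (D0 0%N x) _; rewrite GE; apply: ereal_sup_ubound; exists 0%N.
have intG : (\int[P]_x G x <= (C - \int[P]_x h 0 x)%:E)%E.
  rewrite monotone_convergence//; apply: lime_le.
    apply: ereal_nondecreasing_is_cvgn => m n mn; apply: ge0_le_integral => //.
    by move=> x _; exact: ndD.
  apply: nearW => n; rewrite (Rint_EFin (ID n)) lee_fin RintB//.
  by rewrite lerD2r.
have IG : P.-integrable setT G.
  apply/integrableP; split => //; rewrite (eq_integral G); last first.
    by move=> x _; rewrite gee0_abs.
  exact: le_lt_trans intG (ltry _).
have aeG := integrable_ae measurableT IG.
have mfG : measurable_fun setT (fine \o G) by apply: measurableT_comp => //; exact: fine_measurable.
have IfG : intg P (fine \o G).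
  apply: (le_integrable measurableT _ _ IG) => //; first exact/measurable_EFinP.
  by move=> x _ /=; case: (G x) => [r| |] //=; rewrite ?normr0 ?leey// lexx.
exists (fun x => h 0 x + (fine \o G) x); split.
- exact: intgD.
- rewrite RintD//.
  suff : \int[P]_x (fine \o G) x <= C - \int[P]_x h 0 x by rewrite lerBrDl.
  rewrite -lee_fin -Rint_EFin//; apply: le_trans intG.
  rewrite le_eqVlt; apply/orP; left; apply/eqP.
  apply: ge0_ae_eq_integral => //.
  + exact/measurable_EFinP.
  + by move=> x _ /=; rewrite lee_fin fine_ge0.
  + by apply: filterS aeG => x Gx _ /=; rewrite fineK// Gx.
- apply: filterS aeG => x /(_ I) Gx; split => [n|e e0] /=.
    rewrite addrC -lerBlDr -lee_fin fineK// GE; apply: ereal_sup_ubound.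
    by exists n.
  have : (G x - e%:E < G x)%E by rewrite lteBlDr// lteDl// lte_fin.
  rewrite [X in (_ < X)%E]GE => /ereal_sup_gt[_ [n _ <-]] Gn; exists n.
  by move: Gn; rewrite -(fineK Gx) -EFinB lte_fin /=; lra.
Qed.

(** * Lower bound *)

Section Environment.
Context {d : measure_display} {T : measurableType d} {R : realType}.
Variables (P : probability T R) (Tf Ti : T -> T) (pp pm : T -> R).
Hypotheses (mTf : measurable_fun setT Tf) (mTi : measurable_fun setT Ti).
Hypotheses (TfK : cancel Tf Ti) (TiK : cancel Ti Tf).
Hypothesis TfP : forall A, measurable A -> P (Tf @^-1` A) = P A.
Hypothesis erg : forall A, measurable A -> Tf @^-1` A = A -> P A = 0%E \/ P A = 1%E.
Hypotheses (mpp : measurable_fun setT pp) (mpm : measurable_fun setT pm).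
Hypotheses (pp0 : forall x, 0 < pp x) (pm0 : forall x, 0 < pm x).
Hypothesis pp_pm : forall x, pp x + pm x = 1.
Hypotheses (Ipp : intg P (fun x => ln (pp x))) (Ipm : intg P (fun x => ln (pm x))).
Local Notation hit := (hit Tf Ti pp pm).
Local Notation gf := (gf Tf Ti pp pm).
Implicit Types (N n k : nat) (r s v alpha : R).

Lemma TiP A : measurable A -> P (Ti @^-1` A) = P A.
Proof.
move=> mA; have mTA : measurable (Ti @^-1` A) by rewrite -[_ @^-1` _]setTI; exact: mTi.
rewrite -(TfP mTA); congr (P _); apply/seteqP; split => x /=; by rewrite TfK.
Qed.

Lemma Ti_erg A : measurable A -> Ti @^-1` A = A -> P A = 0%E \/ P A = 1%E.
Proof.
move=> mA TiA; apply: erg => //; rewrite -[in LHS]TiA.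
by apply/seteqP; split => x /=; rewrite TfK.
Qed.

Lemma measurable_hit n j : measurable_fun setT (fun w => hit n w j).
Proof.
elim: n j => [|n IH] [|j] /=; try exact: measurable_cst.
by apply: measurable_funD; apply: measurable_funM => //;
  apply: (measurableT_comp (IH _)).
Qed.

Lemma measurable_gf N r : measurable_fun setT (gf N r).
Proof.
apply: measurable_sum => k; apply: measurable_funM; first exact: measurable_hit.
exact: measurable_cst.
Qed.

(** A passage can be a single step to the right, so the logarithm is at least [ln (pp w) - r];
    truncation bounds it above by a constant. *)
Lemma intg_ln_gf N r : (0 < N)%N -> intg P (fun w => ln (gf N r w)).
Proof.
move=> N0; pose c := ln (N.+1%:R * expR (N%:R * `|r|)).
apply: (intg_le _ (intgD (intg_cst P (`|c| + `|r|)) (intg_norm Ipp))) => [|w /=].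
  by apply: measurableT_comp => //; exact: measurable_gf.
rewrite ler_norml.
have g0 := gf_gt0 Tf Ti pp0 pm0 r w N0.
have h1 : ln (gf N r w) <= c.
  by rewrite ler_ln ?posrE ?mulr_gt0 ?expR_gt0//; exact: gf_le.
have h2 : ln (pp w) - r <= ln (gf N r w).
  rewrite -[- r]expRK -lnM ?posrE ?expR_gt0// ler_ln ?posrE ?mulr_gt0 ?expR_gt0//.
  exact: gf_ge.
have := ler_norm c; have := ler_norm r; have := ler_norm (- ln (pp w)).
rewrite !normrN; have := normr_ge0 r; have := normr_ge0 (ln (pp w)); have := normr_ge0 c.
lra.
Qed.

Definition lgf N r := \int[P]_w ln (gf N r w).

Lemma lgf_nd r M N : (0 < M <= N)%N -> lgf M r <= lgf N r.
Proof.
move=> /andP[M0 MN]; have N0 := leq_trans M0 MN.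
apply: le_Rint => [||w]; [exact: intg_ln_gf|exact: intg_ln_gf|].
by rewrite ler_ln ?posrE ?gf_gt0//; exact: gf_nd.
Qed.

Lemma lgf_lipschitz N r s : (0 < N)%N -> lgf N s <= N%:R * `|r - s| + lgf N r.
Proof.
move=> N0; rewrite -Rint_addc; last exact: intg_ln_gf.
apply: le_Rint => [||w]; first exact: intg_ln_gf.
  by apply: intgD; [exact: intg_cst|exact: intg_ln_gf].
rewrite -[X in X + _]expRK -lnM ?posrE ?expR_gt0 ?gf_gt0//.
by rewrite ler_ln ?posrE ?mulr_gt0 ?expR_gt0 ?gf_gt0//; exact: gf_lipschitz.
Qed.

Lemma lgf_semiconcave N r eta : (0 < N)%N -> 0 <= eta -> N%:R * eta <= 2^-1 ->
  lgf N (r - eta) + lgf N (r + eta) <= 2 * (N%:R * eta) ^+ 2 + 2 * lgf N r.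
Proof.
move=> N0 eta0 Neta; have I s := intg_ln_gf s N0.
have -> : lgf N (r - eta) + lgf N (r + eta) =
  \int[P]_w (ln (gf N (r - eta) w) + ln (gf N (r + eta) w)) by rewrite RintD.
have -> : 2 * lgf N r = \int[P]_w (2 * ln (gf N r w)) by rewrite RintZ.
rewrite -Rint_addc; last exact: intgZ.
apply: le_Rint => [||w]; first exact: intgD.
  by apply: intgD; [exact: intg_cst|exact: intgZ].
have g0 s := gf_gt0 Tf Ti pp0 pm0 s w N0.
have := gf_log_semiconcave Tf Ti pp0 pm0 r w eta0 Neta.
rewrite -ler_ln ?posrE ?mulr_gt0 ?exprn_gt0 ?expR_gt0//.
rewrite [X in _ <= X -> _]lnM ?posrE ?exprn_gt0 ?expR_gt0// expRK lnXn//.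
by rewrite lnM ?posrE// (mulr_natl (ln _) 2).
Qed.

Lemma lgf_ge N r : (0 < N)%N -> \int[P]_w ln (pp w) - r <= lgf N r.
Proof.
move=> N0; rewrite addrC -Rint_addc//.
apply: le_Rint => [||w]; last 1 first.
- rewrite addrC -[X in _ + X]expRK -lnM ?posrE ?expR_gt0//.
  by rewrite ler_ln ?posrE ?mulr_gt0 ?expR_gt0 ?gf_gt0//; exact: gf_ge.
- by apply: intgD => //; exact: intg_cst.
exact: intg_ln_gf.
Qed.

(** Only the path that goes j times to -1 and back before stepping to 1 is kept; its passage time is
    2j + 1. *)
Lemma lgf_ge_odd j : exists c, forall N r, (j.*2.+1 <= N)%N -> c - j.*2.+1%:R * r <= lgf N r.
Proof.
pose h w := j%:R * (ln (pm w) + ln (pp (Ti w))) + ln (pp w).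
have Ih : intg P h.
  apply: intgD => //; apply: intgZ; apply: intgD => //.
  exact: (intg_comp mTi TiP Ipp).
have hh w : expR (h w) <= hit j.*2.+1 w 1.
  rewrite /h {h Ih}; elim: j => [|j IH].
    by rewrite mul0r add0r lnK ?posrE// hit1.
  rewrite doubleS; apply: le_trans (hitSS TiK pp0 pm0 j.*2.+1 w).
  rewrite -natr1 mulrDl mul1r [X in X + _]addrC -addrA expRD expRD !lnK ?posrE//.
  by rewrite ler_wpM2l// mulr_ge0// ltW.
exists (\int[P]_w h w) => N r jN; rewrite addrC -Rint_addc//.
apply: le_Rint => [||w]; last 1 first.
- rewrite -[leLHS]expRK ler_ln ?posrE ?expR_gt0 ?gf_gt0//; last exact: leq_trans jN.
  apply: le_trans (@gf_ge_term _ _ Tf Ti _ _ pp0 pm0 N _ r w jN).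
  by rewrite -expRM_natl expRD mulrC mulrN ler_wpM2r ?expR_ge0.
- by apply: intgD => //; exact: intg_cst.
by apply: intg_ln_gf; exact: leq_trans jN.
Qed.

(** Uniformity in N is what gives a cluster point later. Toward r = +oo the single step yields slope
    1 - v > 0; toward r = -oo passages of 2j + 1 steps yield slope 1 - v (2j + 1) < 0. *)
Lemma sublevel_bounded v : 0 < v < 1 -> exists2 N0, (0 < N0)%N &
  forall alpha, exists A : R, forall N r, (N0 <= N)%N -> v * lgf N r + r <= alpha -> `|r| <= A.
Proof.
move=> /andP[v0 v1].
(* Indeed 2j + 1 >= j + 1 > 1 / v. *)
set j := Num.truncn v^-1; have jv : 1 < v * j.*2.+1%:R.
  rewrite mulrC -ltr_pdivrMr// mul1r; apply: lt_le_trans (truncnS_gt _) _.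
  by rewrite ler_nat ltnS -addnn leq_addr.
have [c Hc] := lgf_ge_odd j; set k := j.*2.+1 in jv Hc *.
exists k => // alpha; set c1 := \int[P]_w ln (pp w).
exists (`|(alpha - v * c1) / (1 - v)| + `|(alpha - v * c) / (v * k%:R - 1)|) => N r kN H.
have N0 : (0 < N)%N by exact: leq_trans kN.
have h1 : r <= (alpha - v * c1) / (1 - v).
  rewrite ler_pdivlMr ?subr_gt0//.
  by have := ler_wpM2l (ltW v0) (lgf_ge r N0); rewrite -/c1; lra.
have h2 : - r <= (alpha - v * c) / (v * k%:R - 1).
  rewrite ler_pdivlMr ?subr_gt0//.
  by have := ler_wpM2l (ltW v0) (Hc N r kN); lra.
move: (_ / (1 - v)) (_ / (_ - 1)) h1 h2 => x y.
have := ler_norm x; have := ler_norm y; have := normr_ge0 x; have := normr_ge0 y.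
by rewrite ler_norml; lra.
Qed.

Lemma continuous_lgf N v : (0 < N)%N -> continuous (fun r => v * lgf N r + r).
Proof.
move=> N0 r.
have key (x y z e : R) : x <= e -> y <= x + z -> z <= x + y -> `|y - z| <= e.
  by move=> *; rewrite ler_norml; lra.
apply: cvgD; last exact: cvg_id.
apply: cvgMr; apply/cvgrPdist_le => e e0.
near=> s.
have : `|r - s| <= e / N%:R.
  by near: s; apply: (@cvgr_dist_le _ _ _ _ _ id r cvg_id); rewrite divr_gt0// ltr0n.
rewrite ler_pdivlMr ?ltr0n// mulrC => rs.
have := lgf_lipschitz r s N0; have := lgf_lipschitz s r N0.
by rewrite (distrC s r); exact: key.
Unshelve. all: by end_near. Qed.

Lemma exists_minimizer v : 0 < v < 1 -> exists2 N0, (0 < N0)%N &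
  forall N, (N0 <= N)%N -> exists r, forall s, v * lgf N r + r <= v * lgf N s + s.
Proof.
move=> v01; have [N0 N00 H] := sublevel_bounded v01; exists N0 => // N NN.
have [A HA] := H (v * lgf N 0 + 0).
have A0 : 0 <= A by have := HA N 0 NN (lexx _); rewrite normr0.
have AA : - A <= A by rewrite (le_trans _ A0)// oppr_le0.
have [r _ Hr] := @EVT_min R (fun r => v * lgf N r + r) (- A) A AA
  (continuous_subspaceT (continuous_lgf (v := v) (leq_trans N00 NN))).
exists r => s; have [sA|As] := leP (v * lgf N s + s) (v * lgf N 0 + 0).
  by apply: Hr; rewrite in_itv /= -ler_norml; exact: (HA N).
apply: le_trans (ltW As); by apply: Hr; rewrite in_itv /= oppr_le0 A0.
Qed.

(** Minimality bounds [lgf N (r + eta)] and [lgf N (r - eta)] from below by the line of slope - 1 /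
    v. The second-difference bound turns each of these into an upper bound for the other, which
    gives the hypotheses of [quenched_prob_lower]. *)
Lemma quenched_lower_minimizer N r v : (0 < N)%N -> 0 < v < 1 ->
  (forall s, v * lgf N r + r <= v * lgf N s + s) ->
  \forall w \ae P, forall alpha, alpha < v * lgf N r + r -> forall eps : R, 0 < eps ->
  exists n0, forall n, (n0 <= n)%N ->
    expR (n%:R * alpha) <=
    quenched_prob Tf Ti pp pm w n [set x | `|x - v| < eps].
Proof.
move=> N0 v01 rmin; have /andP[v0 v1] := v01.
have key1 (a b c e : R) : a + c <= b + (c + e) -> a - e <= b by move=> *; lra.
have key2 (a b c e : R) : a + c <= b + (c - e) -> a + e <= b by move=> *; lra.
have N_gt0 : 0 < N%:R :> R by rewrite ltr0n.
have H : \forall w \ae P, forall k : nat,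
    forall s, s \in [:: r; r - k.+1%:R^-1; r + k.+1%:R^-1] -> forall e : R, 0 < e ->
    exists B : R, forall m,
      `|birkhoff Tf (fun w => ln (gf N s w)) m w - m%:R * lgf N s| <= e * m%:R + B.
  apply/ae_foralln => k.
  have H s := birkhoff_ergodic mTf TfP erg (intg_ln_gf s N0).
  move: (H r) (H (r - k.+1%:R^-1)) (H (r + k.+1%:R^-1)).
  apply: filterS3 => w H1 H2 H3 s.
  by rewrite !inE => /or3P[]/eqP ->; [exact: H1|exact: H2|exact: H3].
have sc0 := @lgf_semiconcave N r _ N0.
move: (lgf N) rmin H sc0 => g rmin H sc0.
apply: filterS H => w Hw alpha Halpha.
apply: (quenched_prob_lower TfK TiK pp0 pm0 pp_pm N0 v01 _ Halpha) => delta delta0.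
(* For eta = 1 / (k + 1) this gives N eta <= 1/2 and 2 (N eta)^2 <= eta delta / 2. Values of eta of
   this form involve a single null set. *)
pose k := Num.truncn (Num.max (2 * N%:R) (4 * N%:R ^+ 2 / delta)).
have eta0 : 0 < k.+1%:R^-1 :> R by rewrite invr_gt0.
have Hk : Num.max (2 * N%:R) (4 * N%:R ^+ 2 / delta) <= k.+1%:R :> R by exact/ltW/truncnS_gt.
move: Hk; rewrite ge_max => /andP[k1 k2]; clearbody k.
have e1 : N%:R * k.+1%:R^-1 <= 2^-1 :> R.
  by rewrite ler_pdivrMr// ler_pdivlMl.
have e2 : 4 * N%:R ^+ 2 * k.+1%:R^-1 <= delta :> R.
  by rewrite ler_pdivrMr// -ler_pdivrMl// mulrC.
have eta1 : k.+1%:R^-1 <= 1 :> R by rewrite invf_le1 ?ltr0n// ler1n.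
have HB := Hw k; move: (k.+1%:R^-1) eta0 eta1 e1 e2 HB => eta eta0 eta1 e1 e2 HB {k1 k2 Hw}.
exists eta; first by rewrite eta0.
have sc := sc0 _ (ltW eta0) e1.
have m1 := rmin (r + eta); have m2 := rmin (r - eta).
have E1 : g r - eta * v^-1 <= g (r + eta).
  by rewrite -(ler_pM2l v0) mulrBr mulrCA mulfV ?gt_eqF// mulr1; exact: key1 m1.
have E2 : g r + eta * v^-1 <= g (r - eta).
  by rewrite -(ler_pM2l v0) mulrDr mulrCA mulfV ?gt_eqF// mulr1; exact: key2 m2.
have E3 : 2 * (N%:R * eta) ^+ 2 <= eta * delta / 2.
  have := ler_wpM2l (ltW eta0) e2; rewrite exprMn [eta ^+ 2]expr2; move: (N%:R ^+ 2) => x.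
  by lra.
move: sc E1 E2 E3; move: (g _) (g _) (g _) (2 * _ ^+ 2) (eta * v^-1) (eta * delta / 2).
move=> g1 g2 g3 x y z h1 h2 h3 h4.
by split; [exact: HB|lra|lra].
Qed.

(* With f = lim_N ln (gf N r), the pair F+ = - f - l, F- = - F+ o T^-1 turns the
   limit of gf_step into the bound e^r on the tilted transition probabilities. *)
Lemma Lambda_le_of_lgf_bounded N0 r C : (0 < N0)%N ->
  (forall N, (N0 <= N)%N -> lgf N r <= C) ->
  exists2 l, (Lambda P Tf pp pm l <= r%:E)%E & - l <= C.
Proof.
move=> N00 HC.
have N1 n : (0 < N0 + n)%N by rewrite addn_gt0 N00.
have [f [If intf aef]] := @intg_monotone_sup _ _ _ P (fun n w => ln (gf (N0 + n) r w)) C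
  (fun n => intg_ln_gf r (N1 n))
  (fun n w => ltac:(by rewrite ler_ln ?posrE ?gf_gt0//; apply: gf_nd => //; rewrite leq_add2l))
  (fun n => HC _ (leq_addr _ _)).
exists (- \int[P]_x f x); last by rewrite opprK.
set l := - \int[P]_x f x.
pose F1 x := - f x - l.
have IF1 : intg P F1 by apply: intgB; [exact: intgN|exact: intg_cst].
have EF1 : \int[P]_x F1 x = 0.
  by rewrite (RintB (intgN If) (intg_cst P _)) Rint_cst RintN// subrr.
pose F2 x := - F1 (Ti x).
have IF1' : intg P (fun x => F1 (Ti x)) := intg_comp mTi TiP IF1.
have IF2 : intg P F2 by exact: intgN.
apply: ge_ereal_inf; exists (ess_sup P (fun x =>
  (ln (pp x * expR (l + F1 x) + pm x * expR (- l + F2 x)))%:E)).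
  exists (F1, F2) => //; split => //=.
  - by rewrite Rint_EFin// EF1.
  - by rewrite Rint_EFin// RintN// (Rint_comp mTi TiP IF1) EF1 oppr0.
  - by move=> x; rewrite /F2 TfK subrr.
apply/ess_supP; move: aef (ae_comp mTi TiP aef).
apply: filterS2 => w [Hw1 Hw2] [Hi1 Hi2].
have -> : l + F1 w = - f w by rewrite /F1; ring.
have -> : - l + F2 w = f (Ti w) by rewrite /F2 /F1; ring.
rewrite lee_fin -[leRHS]expRK ler_ln ?posrE ?expR_gt0//; last first.
  by rewrite addr_gt0 ?mulr_gt0 ?expR_gt0.
(* The monotone limits are reached only up to e in each of the two factors; e^(-2e) >= 1 - 2e makes
   the loss linear. *)
suff H (e : R) : 0 < e -> pp w * expR (- r) +
    pm w * expR (- r) * (expR (f (Ti w) + f w) * (1 - 2 * e)) <= expR (f w).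
  have H' (e : R) : 0 < e ->
    pp w * expR (- f w) + pm w * expR (f (Ti w)) - pm w * expR (f (Ti w)) * 2 * e <= expR r.
    move=> /H; have ra : expR r * expR (- r) = 1 := expRxMexpNx_1 r.
    have fX : expR (- f w) * expR (f w) = 1 by rewrite mulrC expRxMexpNx_1.
    rewrite expRD; move: (pp w) (pm w) ra fX (expR_ge0 r) (expR_ge0 (- f w)).
    move: (expR r) (expR (- r)) (expR (- f w)) (expR (f w)) (expR (f (Ti w))).
    move=> E a X' X Y p q ra fX E0 X0 /(ler_wpM2l (mulr_ge0 E0 X0)).
    rewrite -[E * X' * X]mulrA fX mulr1; apply: le_trans.
    rewrite le_eqVlt; apply/orP; left; apply/eqP.
    transitivity (p * X' * (E * a) + q * Y * (E * a) * (X' * X) * (1 - 2 * e)).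
      by rewrite ra fX; ring.
    by ring.
  rewrite leNgt; apply/negP => lt.
  set K := pm w * expR (f (Ti w)) in lt H'; have K0 : 0 < K by rewrite mulr_gt0 ?expR_gt0.
  (* This e makes the loss exactly half of the supposed excess. *)
  have e0 : 0 < (pp w * expR (- f w) + K - expR r) / (4 * K).
    by apply: divr_gt0; [rewrite subr_gt0|apply: mulr_gt0].
  have := H' _ e0.
  rewrite (_ : K * 2 * (_ / _) = (pp w * expR (- f w) + K - expR r) / 2); first by lra.
  by field; rewrite gt_eqF.
move=> e0; have [n1 Hn1] := Hw2 e e0; have [n2 Hn2] := Hi2 e e0.
pose n := maxn n1 n2; pose M := (N0 + n)%N.
have M0 : (0 < M)%N := N1 n.
have ndL w' m : (m <= n)%N -> ln (gf (N0 + m) r w') <= ln (gf M r w').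
  by move=> mn; rewrite /M ler_ln ?posrE ?gf_gt0//; apply: gf_nd => //; rewrite leq_add2l.
have Mg w' y : y - e < ln (gf M r w') -> expR (y - e) <= gf M r w'.
  move=> /ltW yM; have E : expR (ln (gf M r w')) = gf M r w' by rewrite lnK ?posrE ?gf_gt0.
  by apply: le_trans (_ : _ <= expR (ln (gf M r w'))) _; rewrite ?ler_expR// E.
have G1 : expR (f w - e) <= gf M r w.
  by apply: Mg; apply: lt_le_trans Hn1 (ndL _ _ _); rewrite leq_maxl.
have G2 : expR (f (Ti w) - e) <= gf M r (Ti w).
  by apply: Mg; apply: lt_le_trans Hn2 (ndL _ _ _); rewrite leq_maxr.
(* The index [(M + M).+1] is at least [N0], so its generating function is also below the limit. *)
have G3 : gf (M + M).+1 r w <= expR (f w).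
  have := Hw1 ((M + M).+1 - N0)%N; rewrite subnKC; last by rewrite /M; lia.
  move=> fM; have E : expR (ln (gf (M + M).+1 r w)) = gf (M + M).+1 r w.
    by rewrite lnK ?posrE ?gf_gt0.
  by rewrite -E ler_expR.
apply: le_trans G3; apply: le_trans (gf_step TiK pp0 pm0 r w M0).
rewrite lerD2l ler_wpM2l ?mulr_ge0 ?expR_ge0 ?(ltW (pm0 w))//.
apply: le_trans (ler_pM (expR_ge0 _) (expR_ge0 _) G2 G1).
rewrite -expRD (_ : _ - e + _ = f (Ti w) + f w + - (2 * e)); last by ring.
by rewrite [leRHS]expRD ler_wpM2l ?expR_ge0//; have := expR_ge1Dx (- (2 * e)); lra.
Qed.

(** For fixed M, monotonicity in N and the Lipschitz bound in r carry the inequality from [rN N]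
    with N large to a cluster point r, which then serves every M. With C = (alpha - r) / v, the
    bound - l <= C reads r <= l v + alpha. *)
Lemma Lambda_le_of_minimizers N0 v alpha (rN : nat -> R) : (0 < N0)%N -> 0 < v < 1 ->
  (forall N, (N0 <= N)%N -> v * lgf N (rN N) + rN N <= alpha) ->
  exists l, (Lambda P Tf pp pm l <= (l * v + alpha)%:E)%E.
Proof.
move=> N00 v01 H; have /andP[v0 v1] := v01.
have [N1 N10 HA] := sublevel_bounded v01; have {HA}[A HA] := HA alpha.
pose N2 := maxn N0 N1.
pose u n := rN (N2 + n)%N.
have uA n : `[- A, A]%classic (u n).
  rewrite /= in_itv /= -ler_norml; apply: (HA (N2 + n)%N); rewrite ?H// /N2; lia.
have uF : (u @ \oo) `[- A, A]%classic by exists 0%N => // n _; exact: uA.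
have [r [_ /cluster_eventuallyP Hr]] := @segment_compact R (- A) A (u @ \oo) _ uF.
have key (b D gr gu gn x y e : R) : v * gn + y <= alpha -> v * gu <= v * gn ->
    v * gr <= v * (b * D + gu) -> v * b * D <= v * b * e -> x - y <= D ->
    e * (v * b + 1) = (v * gr + x - alpha) / 2 -> D <= e -> alpha < v * gr + x -> False.
  by move=> *; lra.
have psir M : (N2 <= M)%N -> v * lgf M r + r <= alpha.
  move=> MN; have M0 : (0 < M)%N by move: MN; rewrite /N2; lia.
  rewrite leNgt; apply/negP => lt.
  (* Moving from [u p] to r within distance e costs at most e (v M + 1), half of the excess over
     alpha. *)
  pose e := (v * lgf M r + r - alpha) / (2 * (v * M%:R + 1)).
  have vM : 0 < v * M%:R + 1 by rewrite addr_gt0// mulr_gt0// ltr0n.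
  have e0 : 0 < e by rewrite divr_gt0 ?subr_gt0// mulr_gt0.
  have [p Mp rp] := Hr e M e0.
  have h1 : v * lgf (N2 + p) (u p) + u p <= alpha by apply: H; rewrite /N2; lia.
  have h2 : lgf M (u p) <= lgf (N2 + p) (u p) by apply: lgf_nd; rewrite M0; lia.
  have h3 := lgf_lipschitz (u p) r M0.
  rewrite distrC in h3.
  have eE : e * (v * M%:R + 1) = (v * lgf M r + r - alpha) / 2.
    by rewrite /e; field; rewrite gt_eqF.
  have h4 := ler_wpM2l (ltW v0) h2; have h5 := ler_wpM2l (ltW v0) h3.
  have h6 := ler_wpM2l (ltW (mulr_gt0 v0 (ltac:(by rewrite ltr0n) : 0 < M%:R :> R))) rp.
  have h7 := ler_norm (r - u p).
  exact: key h1 h4 h5 h6 h7 eE rp lt.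
have N20 : (0 < N2)%N by rewrite /N2; lia.
have lgfr N : (N2 <= N)%N -> lgf N r <= (alpha - r) / v.
  by move=> /psir; rewrite ler_pdivlMr//; lra.
have [l Ll lC] := Lambda_le_of_lgf_bounded N20 lgfr.
exists l; apply: le_trans Ll _; rewrite lee_fin.
by move: lC; rewrite ler_pdivlMr//; lra.
Qed.

End Environment.

(** * Extended-real limits and almost sure statements *)

Section Misc.
Context {R : realType}.

Lemma lee_dense (x y : \bar R) : (forall r : R, (r%:E < x)%E -> (r%:E <= y)%E) -> (x <= y)%E.
Proof.
case: x => [x| |] H; last by rewrite leNye.
  apply/lee_subgt0Pr => e e0; rewrite -EFinB; apply: H; rewrite lte_fin; lra.
by rewrite (eq_infty (fun r => H r (ltry r))).
Qed.

Lemma limn_esup_le_near (u : nat -> \bar R) (x : \bar R) n0 :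
  (forall n, (n0 <= n)%N -> (u n <= x)%E) -> (limn_esup u <= x)%E.
Proof.
move=> ux; apply: ge_ereal_inf.
exists (ereal_sup (u @` [set n | (n0 <= n)%N])).
  by exists [set n | (n0 <= n)%N] => //; exists n0.
by apply: ge_ereal_sup => _ [n /= n0n <-]; exact: ux.
Qed.

Lemma limn_einf_ge_near (u : nat -> \bar R) (x : \bar R) n0 :
  (forall n, (n0 <= n)%N -> (x <= u n)%E) -> (x <= limn_einf u)%E.
Proof.
move=> ux; rewrite /limn_einf leeNr; apply: (@limn_esup_le_near _ _ n0) => n n0n.
by rewrite leeN2 ux.
Qed.

Lemma elog_div_le (q x : R) n : (0 < n)%N -> 0 <= q -> q <= expR (n%:R * x) ->
  (elog q * (n%:R^-1)%:E <= x%:E)%E.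
Proof.
move=> n0 q0 qx; rewrite /elog; case: eqP => [_|/eqP qn0].
  by rewrite gt0_mulNye ?leNye// lte_fin invr_gt0 ltr0n.
have {}q0 : 0 < q by rewrite lt_neqAle eq_sym qn0.
rewrite -EFinM lee_fin ler_pdivrMr ?ltr0n//.
by rewrite -[leRHS]expRK ler_ln ?posrE ?expR_gt0// mulrC.
Qed.

Lemma elog_div_ge (q x : R) n : (0 < n)%N -> expR (n%:R * x) <= q ->
  (x%:E <= elog q * (n%:R^-1)%:E)%E.
Proof.
move=> n0 qx; have q0 : 0 < q := lt_le_trans (expR_gt0 _) qx.
rewrite /elog gt_eqF// -EFinM lee_fin ler_pdivlMr ?ltr0n//.
by rewrite -[leLHS]expRK ler_ln ?posrE ?expR_gt0// mulrC.
Qed.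

End Misc.

Section AE.
Context {d : measure_display} {T : measurableType d} {R : realType}.
Variable P : probability T R.

Lemma ae_forall_countType (I : countType) (Q : I -> T -> Prop) :
  (forall i, \forall x \ae P, Q i x) -> \forall x \ae P, forall i, Q i x.
Proof.
move=> H; have : \forall x \ae P, forall n, if @choice.unpickle I n is Some i then Q i x else True.
  by apply/ae_foralln => n; case: (choice.unpickle n) => [i|]; [exact: H|exact: aeW].
by apply: filterS => x Hx i; have := Hx (choice.pickle i); rewrite choice.pickleK.
Qed.

(** The maximum of [f] and [g] dominates [f] everywhere and equals [g] almost everywhere. *)
Lemma le_Rint_ae (f g : T -> R) : intg P f -> intg P g ->
  (\forall x \ae P, f x <= g x) -> \int[P]_x f x <= \int[P]_x g x.
Proof.
move=> If Ig fg; have Im := intg_max If Ig.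
apply: le_trans (_ : _ <= \int[P]_x Num.max (f x) (g x)) _.
  by apply: le_Rint => // x; rewrite le_max lexx.
rewrite le_eqVlt; apply/orP; left; apply/eqP; congr fine.
apply: ae_eq_integral => //; [exact: measurable_int Im|exact: measurable_int Ig|].
by apply: filterS fg => x fgx _; congr EFin; apply/max_idPr.
Qed.

End AE.

(** * Upper bound *)

Section Cocycle.
Context {T : Type} {R : realType}.
Variables (Tf Ti : T -> T) (pp pm : T -> R).
Hypotheses (TfK : cancel Tf Ti) (TiK : cancel Ti Tf).
Hypotheses (pp0 : forall x, 0 < pp x) (pm0 : forall x, 0 < pm x).
Hypothesis pp_pm : forall x, pp x + pm x = 1.
Variables (F1 F2 : T -> R).
Hypothesis FT : forall x, F1 x + F2 (Tf x) = 0.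
Let pp0' x : 0 <= pp x := ltW (pp0 x).
Let pm0' x : 0 <= pm x := ltW (pm0 x).

(* As F+ + F- o T = 0, the sum of F along a path from 0 to z depends only on z. *)
Definition corrector w (z : int) : R :=
  match z with
  | Posz n => birkhoff Tf F1 n w
  | Negz n => birkhoff Ti F2 n.+1 w
  end.

Lemma corrector_add1 w z : corrector w (z + 1) = F1 w + corrector (Tf w) z.
Proof.
case: z => [n|n]; first by rewrite -PoszD addn1 /= birkhoffS.
rewrite [corrector (Tf w) _]/= (_ : corrector w (Negz n + 1) = birkhoff Ti F2 n w).
  by rewrite birkhoffS TfK addrA FT add0r.
case: n => [|n]; first by rewrite /= !birkhoff0.
by rewrite (_ : Negz n.+1 + 1 = Negz n)//; lia.
Qed.

Lemma corrector_sub1 w z : corrector w (z - 1) = F2 w + corrector (Ti w) z.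
Proof.
have := corrector_add1 (Ti w) (z - 1); rewrite subrK TiK => ->.
by rewrite addrA [F2 w + _]addrC -[in F2 w](TiK w) FT add0r.
Qed.

(** Both directions are included so that the property passes to [Tf w] and [Ti w], as inductions
    along the walk require. *)
Definition on_orbit (Q : T -> Prop) w := forall n, Q (iter n Tf w) /\ Q (iter n Ti w).

Lemma on_orbit_Tf Q w : on_orbit Q w -> on_orbit Q (Tf w).
Proof.
move=> H n; rewrite -iterSr; split; first by have [] := H n.+1.
case: n => [|n]; first by have [] := H 1%N.
by rewrite iterSr TfK; have [] := H n.
Qed.

Lemma on_orbit_Ti Q w : on_orbit Q w -> on_orbit Q (Ti w).
Proof.
move=> H n; rewrite -[iter n Ti _]iterSr; split; last by have [] := H n.+1.
case: n => [|n]; first by have [] := H 1%N.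
by rewrite iterSr TiK; have [] := H n.
Qed.

(** The exponential of l X_n + corrector - n r is a supermartingale: by the cocycle relations each
    step contributes the tilted sum at the current environment, which is at most e^r. *)
Lemma walk_expect_exp_corrector (l r : R) n w :
  on_orbit (fun w => pp w * expR (l + F1 w) + pm w * expR (- l + F2 w) <= expR r) w ->
  walk_expect Tf Ti pp pm n (fun z => expR (l * z%:~R + corrector w z)) w <= expR (n%:R * r).
Proof.
elim: n w => [|n IH] w H /=; first by rewrite birkhoff0 addr0 mulr0 mul0r.
have E1 : (fun z => expR (l * (z + 1)%:~R + corrector w (z + 1))) =
    fun z => expR (l + F1 w) * expR (l * z%:~R + corrector (Tf w) z).
  by apply/funext => z; rewrite corrector_add1 -expRD intrD; congr expR; ring.
have E2 : (fun z => expR (l * (z - 1)%:~R + corrector w (z - 1))) =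
    fun z => expR (- l + F2 w) * expR (l * z%:~R + corrector (Ti w) z).
  by apply/funext => z; rewrite corrector_sub1 -expRD intrD; congr expR; ring.
rewrite E1 E2 !walk_expectZ.
apply: le_trans (_ : (pp w * expR (l + F1 w) + pm w * expR (- l + F2 w)) * expR (n%:R * r) <= _).
  rewrite mulrDl; apply: lerD; rewrite mulrA ler_wpM2l ?mulr_ge0 ?expR_ge0//; apply: IH.
    exact: on_orbit_Tf.
  exact: on_orbit_Ti.
rewrite -[n.+1%:R]natr1 [(_ + 1) * r]mulrDl mul1r [expR (_ + r)]expRD [leLHS]mulrC ler_wpM2l ?expR_ge0//.
by have [] := H 0%N.
Qed.

(** The indicator of the half-line is bounded by an exponential of l z + corrector; since |z| <= n,
    inserting the corrector costs at most e n + B. *)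
Lemma half_line_prob_le (l r alpha e B : R) n w :
  on_orbit (fun w => pp w * expR (l + F1 w) + pm w * expR (- l + F2 w) <= expR r) w ->
  0 <= e -> (forall z, `|corrector w z| <= e * `|z|%N%:R + B) -> (0 < n)%N ->
  walk_expect Tf Ti pp pm n (fun z => (alpha < l * (z%:~R / n%:R) - r)%R%:R) w
    <= expR (n%:R * (e - alpha) + B).
Proof.
move=> H e0 HB n0; have n0' : 0 < n%:R :> R by rewrite ltr0n.
apply: le_trans (_ : walk_expect Tf Ti pp pm n (fun z =>
   expR (n%:R * (e - alpha - r) + B) * expR (l * z%:~R + corrector w z)) w <= _).
  apply: walk_expect_le => // z zn; case: (boolP (alpha < _)) => [az|_] /=; last first.
    by rewrite mulr_ge0 ?expR_ge0.
  rewrite -expRD -[leLHS](@expR0 R) ler_expR.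
  have := HB z; rewrite ler_norml => /andP[Bz _].
  have ez : e * `|z|%N%:R <= e * n%:R by rewrite ler_wpM2l// ler_nat.
  have := ltr_pM2l n0' alpha (l * (z%:~R / n%:R) - r); rewrite az.
  have -> : n%:R * (l * (z%:~R / n%:R) - r) = l * z%:~R - n%:R * r.
    by rewrite mulrBr; congr (_ - _); rewrite mulrCA; congr (_ * _); rewrite mulrC divfK ?gt_eqF.
  by lra.
rewrite walk_expectZ.
apply: le_trans (ler_wpM2l (expR_ge0 _) (walk_expect_exp_corrector n H)) _.
by rewrite -expRD ler_expR; lra.
Qed.

End Cocycle.

Section Upper.
Context {d : measure_display} {T : measurableType d} {R : realType}.
Variables (P : probability T R) (Tf Ti : T -> T) (pp pm : T -> R).
Hypotheses (mTf : measurable_fun setT Tf) (mTi : measurable_fun setT Ti).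
Hypotheses (TfK : cancel Tf Ti) (TiK : cancel Ti Tf).
Hypothesis TfP : forall A, measurable A -> P (Tf @^-1` A) = P A.
Hypothesis erg : forall A, measurable A -> Tf @^-1` A = A -> P A = 0%E \/ P A = 1%E.
Hypotheses (mpp : measurable_fun setT pp) (mpm : measurable_fun setT pm).
Hypotheses (pp0 : forall x, 0 < pp x) (pm0 : forall x, 0 < pm x).
Hypothesis pp_pm : forall x, pp x + pm x = 1.
Hypotheses (Ipp : intg P (fun x => ln (pp x))) (Ipm : intg P (fun x => ln (pm x))).
Local Notation Lambda := (Lambda P Tf pp pm).
Local Notation rateI := (rateI P Tf pp pm).
Implicit Types (l r s v alpha beta : R).

Definition tilt (F : (T -> R) * (T -> R)) l x : R :=
  pp x * expR (l + F.1 x) + pm x * expR (- l + F.2 x).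

Lemma tilt_gt0 F l x : 0 < tilt F l x.
Proof. by rewrite addr_gt0// mulr_gt0// expR_gt0. Qed.

Lemma tilt_shift F l l' x : ln (tilt F l' x) <= ln (tilt F l x) + `|l' - l|.
Proof.
rewrite -[X in _ + X]expRK -lnM ?posrE ?tilt_gt0 ?expR_gt0//.
rewrite ler_ln ?posrE ?mulr_gt0 ?tilt_gt0 ?expR_gt0// mulrDl.
rewrite -!mulrA -!expRD; apply: lerD; rewrite ler_wpM2l ?(ltW (pp0 _)) ?(ltW (pm0 _))// ler_expR.
  by have := ler_norm (l' - l); lra.
by have := ler_norm (l - l'); rewrite distrC; lra.
Qed.

Lemma Lambda_lt_witness l s : (Lambda l < s%:E)%E -> exists F, classK P Tf F /\
  \forall x \ae P, tilt F l x <= expR s.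
Proof.
move=> /ereal_inf_lt[_ [F KF <-] /ltW Fs]; exists F; split => //.
have /ess_supP := Fs; apply: filterS => x.
by rewrite lee_fin -/(tilt F l x) -[X in _ <= X -> _](expRK s) ler_ln ?posrE ?expR_gt0 ?tilt_gt0.
Qed.

(** With the same F, each tilted sum changes by a factor of at most e^|l' - l|. This lets rational l
    replace real ones in the upper bound. *)
Lemma Lambda_shift l l' s : (Lambda l < s%:E)%E -> (Lambda l' < (s + `|l' - l|)%:E)%E.
Proof.
move=> /ereal_inf_lt[_ [F KF <-] Fs].
apply: (@le_lt_trans _ _ (ess_sup P (fun x => (ln (tilt F l x))%:E) + `|l' - l|%:E)%E).
  apply: ge_ereal_inf; exists (ess_sup P (fun x => (ln (tilt F l' x))%:E)); first by exists F.
  apply/ess_supP; have := ess_sup_ge P (fun x => (ln (tilt F l x))%:E); apply: filterS => x Hx.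
  apply: le_trans (leeD2r _ Hx); rewrite -EFinD lee_fin; exact: tilt_shift.
by rewrite EFinD lteD2rE.
Qed.

Lemma Lambda_le_norm l : (Lambda l <= `|l|%:E)%E.
Proof.
apply: ge_ereal_inf; exists (ess_sup P (fun x => (ln (tilt (cst 0, cst 0) l x))%:E)).
  exists (cst 0, cst 0) => //; split => //=.
  - exact: (intg_cst P 0).
  - exact: (intg_cst P 0).
  - by rewrite integral0.
  - by rewrite integral0.
  - by move=> x; rewrite addr0.
apply/ess_supP; apply: aeW => x; rewrite lee_fin -[leRHS]expRK.
rewrite ler_ln ?posrE ?expR_gt0 ?tilt_gt0// /tilt /= !addr0.
rewrite -[leRHS]mul1r -(pp_pm x) mulrDl.
apply: lerD; rewrite ler_wpM2l ?(ltW (pp0 _)) ?(ltW (pm0 _))// ler_expR.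
  exact: ler_norm.
by have := ler_norm (- l); rewrite normrN.
Qed.

(* Jensen's inequality, keeping a single branch of the walk. *)
Lemma Lambda_ge (p : T -> R) (G : (T -> R) * (T -> R) -> T -> R) c l :
  intg P (fun x => ln (p x)) -> (forall x, 0 < p x) ->
  (forall F, classK P Tf F -> intg P (G F) /\ \int[P]_x G F x = 0) ->
  (forall F x, p x * expR (c + G F x) <= tilt F l x) ->
  ((\int[P]_x ln (p x) + c)%:E <= Lambda l)%E.
Proof.
move=> Ip p0 KG pG; apply: le_ereal_inf_tmp => _ [F KF <-].
have := ess_sup_ge P (fun x => (ln (tilt F l x))%:E).
rewrite -/(tilt F l); move: (ess_sup _ _) => [s| |] H.
- have [IG EG] := KG F KF.
  have I1 := intgD Ip (intgD (intg_cst P c) IG).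
  rewrite lee_fin.
  have -> : \int[P]_x ln (p x) + c = \int[P]_x (ln (p x) + (cst c x + G F x)).
    by rewrite (RintD Ip (intgD (intg_cst P c) IG)) Rint_addc// EG addr0.
  rewrite -[leRHS](Rint_cst P s); apply: le_Rint_ae => //; first exact: intg_cst.
  apply: filterS H => x; rewrite lee_fin; apply: le_trans => /=.
  rewrite -[X in _ + X]expRK -lnM ?posrE ?expR_gt0//.
  by rewrite ler_ln ?posrE ?tilt_gt0 ?mulr_gt0 ?expR_gt0//; exact: pG.
- by rewrite leey.
(* An essential supremum equal to -oo would be above a real number at some point. *)
- by have [x] := ae_ex H; rewrite leeNy_eq.
Qed.

Lemma Lambda_ge_pp l : ((\int[P]_x ln (pp x) + l)%:E <= Lambda l)%E.
Proof.
apply: (@Lambda_ge pp (fun F => F.1)) => // [F [I1 _ E1 _ _]|F x].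
  by split => //; apply: EFin_inj; rewrite -Rint_EFin.
by rewrite /tilt lerDl mulr_ge0 ?expR_ge0 ?(ltW (pm0 x)).
Qed.

Lemma Lambda_ge_pm l : ((\int[P]_x ln (pm x) - l)%:E <= Lambda l)%E.
Proof.
apply: (@Lambda_ge pm (fun F => F.2)) => // [F [_ I2 _ E2 _]|F x].
  by split => //; apply: EFin_inj; rewrite -Rint_EFin.
by rewrite /tilt lerDr mulr_ge0 ?expR_ge0 ?(ltW (pp0 x)).
Qed.

Lemma Lambda_fin l : exists L, Lambda l = L%:E.
Proof.
have := Lambda_le_norm l; have := Lambda_ge_pp l.
by case: (Lambda l) => [L _ _| |] //; exists L.
Qed.

Lemma rateI_gtP x alpha : (alpha%:E < rateI x)%E -> exists l, (Lambda l < (l * x - alpha)%:E)%E.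
Proof.
move=> /ereal_sup_gt[_ [l _ <-]]; have [L LE] := Lambda_fin l.
by rewrite LE -EFinB lte_fin => H; exists l; rewrite LE lte_fin; lra.
Qed.

Lemma rateI_ge x l L : (Lambda l <= L%:E)%E -> ((l * x - L)%:E <= rateI x)%E.
Proof.
move=> H; apply: le_trans (_ : _ <= (l * x)%:E - Lambda l)%E _.
  by rewrite EFinB leeB.
by apply: ereal_sup_ubound; exists l.
Qed.

(** The two lower bounds give Lambda(l) >= |l| - c, while l x <= |l|. *)
Lemma rateI_bounded : exists c : R, forall x, `|x| <= 1 -> (rateI x <= c%:E)%E.
Proof.
exists (`|\int[P]_x ln (pp x)| + `|\int[P]_x ln (pm x)|) => x x1.
apply: ge_ereal_sup => _ [l _ <-].
have := Lambda_ge_pp l; have := Lambda_ge_pm l; have [L ->] := Lambda_fin l.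
rewrite -EFinB !lee_fin.
move: (\int[P]_x ln (pp x)) (\int[P]_x ln (pm x)) => c1 c2 h2 h1.
have := ler_norm (- c1); have := ler_norm (- c2); rewrite !normrN => n2 n1.
have := normr_ge0 c1; have := normr_ge0 c2 => p2 p1.
have : l * x <= `|l|.
  by apply: le_trans (ler_norm _) _; rewrite normrM ler_piMr.
by case: (ger0P l) => _; lra.
Qed.

Lemma rateI_pinfty x : 1 < `|x| -> rateI x = +oo%E.
Proof.
move=> x1; apply: eq_infty => M.
(* Since Lambda(l) <= |l|, it suffices that l has the sign of x and |l| (|x| - 1) = |M|. *)
pose l := Num.sg x * (`|M| / (`|x| - 1)).
have x0 : x != 0 by rewrite -normr_gt0 (lt_trans _ x1).
apply: le_trans (rateI_ge x (Lambda_le_norm l)); rewrite lee_fin.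
have -> : l * x = `|M| / (`|x| - 1) * `|x|.
  by rewrite /l mulrAC -normrEsg mulrC.
have q0 : 0 <= `|M| / (`|x| - 1) by rewrite divr_ge0// subr_ge0 ltW.
have -> : `|l| = `|M| / (`|x| - 1).
  by rewrite /l normrM normr_sg x0 mul1r ger0_norm.
rewrite -[X in _ - X]mulr1 -mulrBr divfK; first exact: ler_norm.
by rewrite gt_eqF// subr_gt0.
Qed.

Lemma rateI_ge0 x : (0 <= rateI x)%E.
Proof.
have := rateI_ge x (Lambda_le_norm 0); rewrite mul0r normr0 subr0.
exact.
Qed.

Lemma rateI_convex x y t (a b : R) : 0 <= t <= 1 ->
  (rateI x <= a%:E)%E -> (rateI y <= b%:E)%E ->
  (rateI ((1 - t) * x + t * y) <= ((1 - t) * a + t * b)%:E)%E.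
Proof.
move=> /andP[t0 t1] xa yb; apply: ge_ereal_sup => _ [l _ <-].
have [L LE] := Lambda_fin l.
have hx : ((l * x - L)%:E <= a%:E)%E by apply: le_trans xa; apply: rateI_ge; rewrite LE.
have hy : ((l * y - L)%:E <= b%:E)%E by apply: le_trans yb; apply: rateI_ge; rewrite LE.
move: hx hy; rewrite LE -EFinB !lee_fin => hx hy.
have t1' : 0 <= 1 - t by rewrite subr_ge0.
have := lerD (ler_wpM2l t1' hx) (ler_wpM2l t0 hy).
by apply: le_trans; rewrite le_eqVlt; apply/orP; left; apply/eqP; ring.
Qed.

Lemma ae_on_orbit (Q : T -> Prop) : (\forall x \ae P, Q x) ->
  \forall x \ae P, on_orbit Tf Ti Q x.
Proof.
move=> H; have TiP' := TiP mTi TfK TfP.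
move: (ae_iter mTf TfP H) (ae_iter mTi TiP' H).
by apply: filterS2 => x h1 h2 n.
Qed.

(** The null set depends on l and r only. The condition on [Lambda l] stands after the almost sure
    quantifier so that all rational pairs can be treated at once. *)
Lemma half_line_ae l r : \forall w \ae P, (Lambda l < r%:E)%E -> forall e : R, 0 < e ->
  exists B : R, forall alpha n, (0 < n)%N ->
    walk_expect Tf Ti pp pm n (fun z => (alpha < l * (z%:~R / n%:R) - r)%R%:R) w
      <= expR (n%:R * (e - alpha) + B).
Proof.
have [lr|] := boolP (Lambda l < r%:E)%E; last by move=> _; exact: aeW.
have [[F1 F2] [[/= I1 I2 E1 E2 FT] Hae]] := Lambda_lt_witness lr.
have TiP' := TiP mTi TfK TfP; have Ti_erg' := Ti_erg TfK erg.
have b1 := birkhoff_ergodic mTf TfP erg I1.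
have b2 := birkhoff_ergodic mTi TiP' Ti_erg' I2.
move: (ae_on_orbit Hae) b1 b2; apply: filterS3 => w H b1 b2 _ e e0.
have [B1 HB1] := b1 e e0; have [B2 HB2] := b2 e e0.
have Z1 : \int[P]_x F1 x = 0 by apply: EFin_inj; rewrite -Rint_EFin.
have Z2 : \int[P]_x F2 x = 0 by apply: EFin_inj; rewrite -Rint_EFin.
exists (`|B1| + `|B2|) => alpha n n0.
apply: (half_line_prob_le TfK TiK pp0 pm0 FT alpha H (ltW e0) _ n0) => -[k|k] /=.
  have := HB1 k; rewrite Z1 mulr0 subr0 => /le_trans; apply.
  by have := ler_norm B1; have := normr_ge0 B2; lra.
have := HB2 k.+1; rewrite Z2 mulr0 subr0 => /le_trans; apply.
by have := ler_norm B2; have := normr_ge0 B1; lra.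
Qed.

Theorem ldp_upper_bound : \forall w \ae P, forall A : set R, closed A ->
  (limn_esup (fun n => elog (quenched_prob Tf Ti pp pm w n A) * (n%:R^-1)%:E)
    <= - ereal_inf (rateI @` A))%E.
Proof.
have := @ae_forall_countType _ _ _ P (rat * rat)%type _
  (fun q => half_line_ae (ratr q.1) (ratr q.2)).
apply: filterS => w Hw A clA; rewrite leeNr; apply: lee_dense => alpha Halpha.
rewrite leeNr -EFinN; apply/lee_addgt0Pr => e e0; rewrite -EFinD.
have rateA x : A x -> (alpha%:E < rateI x)%E.
  by move=> Ax; apply: lt_le_trans Halpha _; apply: ereal_inf_lbound; exists x.
pose D := [set q : rat * rat | (Lambda (ratr q.1) < (ratr q.2)%:E)%E].
pose f (q : rat * rat) := [set y : R | alpha < ratr q.1 * y - ratr q.2].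
have fo q : D q -> open (f q).
  move=> _; apply: (@open_comp _ _ (fun y : R => ratr q.1 * y - ratr q.2) [set t | alpha < t]).
    move=> y _; apply: cvgB; [apply: cvgMr; exact: cvg_id|exact: cvg_cst].
  exact: open_gt.
(* The walk satisfies |X_n / n| <= 1, so only this compact part of [A] is ever visited. *)
pose K := A `&` `[- 1, 1]%classic.
have cK : compact K.
  by rewrite /K setIC; apply: compact_closedI => //; exact: segment_compact.
have Kcov : K `<=` cover D f.
  move=> x [Ax]; rewrite /= in_itv /= -ler_norml => x1.
  have [l] := rateI_gtP (rateA x Ax); have [L LE] := Lambda_fin l.
  (* The gap g is shared out: [q1] lies within g / 4 of l, so Lambda at [q1] is below L + g / 2 <
     [q2], while [q1] x - [q2] > l x - L - g = alpha. *)
  rewrite LE lte_fin => Ll; pose g := l * x - alpha - L.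
  have g0 : 0 < g by rewrite /g; lra.
  have [q1] : exists q, ratr q \in `]l, (l + g / 4)[ by apply: rat_in_itvoo; lra.
  rewrite in_itv /= => /andP[q1a q1b].
  have [q2] : exists q, ratr q \in `](L + g / 2), (L + 3 * g / 4)[.
    by apply: rat_in_itvoo; lra.
  rewrite in_itv /= => /andP[q2a q2b].
  have q1l : `|ratr q1 - l| < g / 4 by rewrite gtr0_norm; lra.
  exists (q1, q2) => /=.
    have : (Lambda l < (L + g / 4)%:E)%E by rewrite LE lte_fin; lra.
    move=> /(Lambda_shift (ratr q1)) /lt_le_trans; apply; rewrite lee_fin; lra.
  have : - `|ratr q1 - l| <= (ratr q1 - l) * x.
    rewrite lerNl -mulNr; apply: le_trans (ler_norm _) _.
    by rewrite normrM normrN ler_piMr.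
  by move: q2b q1l; rewrite /f /= /g; move: (ratr q1) (ratr q2) => a b; lra.
move: cK; rewrite compact_cover => /(_ _ D f fo Kcov)[D' D'D Kcov'].
(* One half of e pays for the corrector, the other for the number of half-lines and their
   constants. *)
have e20 : 0 < e / 2 by lra.
have HB q : exists B : R, q \in D' -> forall n, (0 < n)%N ->
    walk_expect Tf Ti pp pm n (fun z => (alpha < ratr q.1 * (z%:~R / n%:R) - ratr q.2)%R%:R) w
      <= expR (n%:R * (e / 2 - alpha) + B).
  have [qD'|] := boolP (q \in D'); last by exists 0.
  have qD : D q := set_mem (D'D q qD').
  by have [B HB] := Hw q qD _ e20; exists B => _ n; exact: HB.
have [B {}HB] := choice HB.
pose M := \sum_(q <- D') expR (B q).
have M0 : 0 <= M by apply: sumr_ge0 => q _; exact: expR_ge0.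
apply: (@limn_esup_le_near _ _ _ (Num.truncn (M / (e / 2))).+1) => n n0n.
have n0 : (0 < n)%N by apply: leq_trans n0n.
have n0' : 0 < n%:R :> R by rewrite ltr0n.
apply: elog_div_le => //.
  apply: sumr_ge0 => s _; elim: (tval s) (0 : int) => [|b s' IH] z //=.
  by case: b; rewrite mulr_ge0// ltW.
rewrite (quenched_probE _ _ TfK TiK).
apply: le_trans (_ : walk_expect Tf Ti pp pm n (fun z =>
   \sum_(q <- D') (alpha < ratr q.1 * (z%:~R / n%:R) - ratr q.2)%R%:R) w <= _).
  apply: walk_expect_le => [x|x|z zn]; [exact: ltW|exact: ltW|].
  case: asboolP => [Az|_] /=; last by apply: sumr_ge0 => q _; rewrite ler0n.
  have [|q qD' fq] := Kcov' (z%:~R / n%:R).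
    split => //; rewrite /= in_itv /= -ler_norml normrM normfV (ger0_norm (ltW n0')).
    rewrite ler_pdivrMr// mul1r -intr_norm -abszE -[n%:R]/(n%:Z%:~R) ler_int lez_nat//.
  rewrite (big_rem q)//= (_ : (alpha < _) = true)//= lerDl.
  by apply: sumr_ge0 => q' _; rewrite ler0n.
rewrite walk_expect_sum.
apply: le_trans (_ : \sum_(q <- D') expR (n%:R * (e / 2 - alpha)) * expR (B q) <= _).
  rewrite big_seq [leRHS]big_seq; apply: ler_sum => q qD'.
  by rewrite -expRD; exact: HB.
rewrite -mulr_sumr -/M.
have Mn : M <= expR (n%:R * (e / 2)).
  have : M <= n%:R * (e / 2).
    rewrite -ler_pdivrMr//; apply: ltW; apply: lt_le_trans (truncnS_gt _) _.
    by rewrite ler_nat.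
  by have := expR_ge1Dx (n%:R * (e / 2)); lra.
apply: le_trans (ler_wpM2l (expR_ge0 _) Mn) _.
by rewrite -expRD ler_expR; lra.
Qed.

End Upper.

(** * Reflection of the line, exchanging T with its inverse and p+ with p- *)

Section Reflection.
Context {d : measure_display} {T : measurableType d} {R : realType}.
Variables (P : probability T R).

Lemma classK_swap (Tf Ti : T -> T) (F1 F2 : T -> R) : cancel Ti Tf ->
  classK P Tf (F1, F2) -> classK P Ti (F2, F1).
Proof.
by move=> TiK [I1 I2 E1 E2 H]; split => //= x; have := H (Ti x); rewrite /= TiK addrC.
Qed.

Lemma Lambda_swap (Tf Ti : T -> T) (pp pm : T -> R) l : cancel Tf Ti -> cancel Ti Tf ->
  Lambda P Ti pm pp l = Lambda P Tf pp pm (- l).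
Proof.
move=> TfK TiK; apply: (congr1 (@ereal_inf R)).
apply/seteqP; split => _ [[F1 F2] KF <-]; exists (F2, F1).
- exact: classK_swap TfK KF.
- by congr (ess_sup _ _); apply/funext => x /=; rewrite opprK addrC.
- exact: classK_swap TiK KF.
- by congr (ess_sup _ _); apply/funext => x /=; rewrite opprK addrC.
Qed.

Lemma rateI_swap (Tf Ti : T -> T) (pp pm : T -> R) v : cancel Tf Ti -> cancel Ti Tf ->
  rateI P Ti pm pp (- v) = rateI P Tf pp pm v.
Proof.
move=> TfK TiK; apply: (congr1 (@ereal_sup R)); apply/seteqP; split => _ [l _ <-];
  (exists (- l); first exact: I).
  by rewrite (Lambda_swap pp pm l TfK TiK) mulrN mulNr.
by rewrite (Lambda_swap pp pm (- l) TfK TiK) opprK mulrNN.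
Qed.

Lemma walk_expect_swap (Tf Ti : T -> T) (pp pm : T -> R) n g w :
  walk_expect Ti Tf pm pp n g w = walk_expect Tf Ti pp pm n (fun z => g (- z)) w.
Proof.
elim: n g w => [|n IH] g w /=; first by rewrite oppr0.
rewrite !IH [LHS]addrC; congr (_ * _ + _ * _); congr (walk_expect _ _ _ _ _ _ _).
  by apply/funext => z; congr (g _); ring.
by apply/funext => z; congr (g _); ring.
Qed.

Lemma quenched_prob_swap (Tf Ti : T -> T) (pp pm : T -> R) n w (v e : R) :
  cancel Tf Ti -> cancel Ti Tf ->
  quenched_prob Ti Tf pm pp w n [set x | `|x - - v| < e] =
  quenched_prob Tf Ti pp pm w n [set x | `|x - v| < e].
Proof.
move=> TfK TiK; rewrite !quenched_probE// walk_expect_swap.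
congr (walk_expect _ _ _ _ _ _ _); apply/funext => z; congr (`[< _ >]%:R).
by rewrite /= opprK -normrN opprD mulrNz mulNr opprK.
Qed.

End Reflection.

(** * Lower bound for all open sets *)

Section Lower.
Context {d : measure_display} {T : measurableType d} {R : realType}.

Lemma quenched_lower_pos (P : probability T R) (Tf Ti : T -> T) (pp pm : T -> R) (v : R) :
  measurable_fun setT Tf -> measurable_fun setT Ti -> cancel Tf Ti -> cancel Ti Tf ->
  (forall A, measurable A -> P (Tf @^-1` A) = P A) ->
  (forall A, measurable A -> Tf @^-1` A = A -> P A = 0%E \/ P A = 1%E) ->
  measurable_fun setT pp -> measurable_fun setT pm ->
  (forall x, 0 < pp x) -> (forall x, 0 < pm x) -> (forall x, pp x + pm x = 1) ->
  intg P (fun x => ln (pp x)) -> intg P (fun x => ln (pm x)) -> 0 < v < 1 ->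
  \forall w \ae P, forall alpha : R, (alpha%:E < - rateI P Tf pp pm v)%E ->
    forall eps : R, 0 < eps -> exists n0, forall n, (n0 <= n)%N ->
    expR (n%:R * alpha) <= quenched_prob Tf Ti pp pm w n [set x | `|x - v| < eps].
Proof.
move=> mTf mTi TfK TiK TfP erg mpp mpm pp0 pm0 pp_pm Ipp Ipm v01.
have [N0 N00 Hmin] := exists_minimizer mTf mTi TfK TiK TfP mpp mpm pp0 pm0 pp_pm Ipp Ipm v01.
(* The minimizers are fixed before [w], so that only countably many null sets are removed. *)
have /choice[rN HrN] : forall N, exists r, (N0 <= N)%N ->
    forall s, v * lgf P Tf Ti pp pm N r + r <= v * lgf P Tf Ti pp pm N s + s.
  move=> N; have [NN|_] := leqP N0 N; last by exists 0.
  by have [r Hr] := Hmin N NN; exists r.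
have H : \forall w \ae P, forall N, (N0 <= N)%N -> forall alpha : R,
    alpha < v * lgf P Tf Ti pp pm N (rN N) + rN N -> forall eps : R, 0 < eps ->
    exists n0, forall n, (n0 <= n)%N ->
    expR (n%:R * alpha) <= quenched_prob Tf Ti pp pm w n [set x | `|x - v| < eps].
  apply/ae_foralln => N; have [NN|_] := leqP N0 N; last exact: aeW.
  have := quenched_lower_minimizer mTf mTi TfK TiK TfP erg mpp mpm pp0 pm0 pp_pm Ipp
    (leq_trans N00 NN) v01 (HrN N NN).
  by apply: filterS => w Hw _.
apply: filterS H => w Hw alpha Halpha.
have [[N [NN Nalpha]]|none] := pselect (exists N, (N0 <= N)%N /\
    alpha < v * lgf P Tf Ti pp pm N (rN N) + rN N); first exact: (Hw N).
have [|l] := @Lambda_le_of_minimizers _ _ _ P Tf Ti pp pm mTf mTi TfK TiK TfP mpp mpm pp0 pm0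
    pp_pm Ipp Ipm N0 v alpha rN N00 v01.
  by move=> N NN; rewrite leNgt; apply/negP => Nalpha; apply: none; exists N.
move=> /(rateI_ge v); rewrite opprD addrA subrr add0r EFinN => ge.
by move: Halpha; rewrite lteNr => /lt_le_trans /(_ ge); rewrite ltxx.
Qed.

(** Writing q as a combination of x and y with a small weight on y lets convexity keep I(q) close to
    I(x), with no continuity of I at the excluded speeds 0, 1 and -1. Rational q leave a single null
    set. *)
Lemma rat_approx (x s : R) : `|x| <= 1 -> 0 < s -> exists q : rat,
  [/\ 0 < `|ratr q : R| < 1, `|ratr q - x| < s &
      exists t y : R, [/\ 0 <= t <= s, `|y| <= 1 & ratr q = (1 - t) * x + t * y]].
Proof.
wlog : x / x <= 0.
  move=> H x1 s0; have [/H|x0] := leP x 0; first exact.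
  have [||//|q [q01 qx [t [y [ts y1 E]]]]] := H (- x); [by rewrite oppr_le0 ltW|by rewrite normrN|].
  exists (- q); rewrite rmorphN /= normrN; split => //.
    by rewrite -normrN opprD !opprK addrC -[x]opprK addrC.
  exists t, (- y); rewrite normrN; split => //; rewrite E; ring.
move=> x0; rewrite ler_norml => /andP[x1 _] s0.
(* The point moves from x <= 0 toward 1/2, a distance of at least 1/2; a move below s / 4 therefore
   has weight below s / 2, and 1/4 keeps q below 1/2. *)
pose m := Num.min (s / 4) (1 / 4).
have m0 : 0 < m by rewrite /m lt_min; lra.
have [ms m1] : m <= s / 4 /\ m <= 1 / 4 by rewrite /m !ge_min !lexx orbT.
have [q [qn0 xq qm]] : exists q : rat, [/\ (ratr q : R) != 0, x < ratr q & ratr q < x + m].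
  move: x0; rewrite le_eqVlt => /orP[/eqP x0|x0].
    have [q] := @rat_in_itvoo R x (x + m) ltac:(lra).
    rewrite in_itv /= => /andP[q1 q2]; exists q; split => //.
    by rewrite gt_eqF// -x0.
  (* q is kept negative because speed 0 is not covered by [quenched_lower]. *)
  have [q] := @rat_in_itvoo R x (Num.min (x + m) 0) ltac:(by rewrite lt_min x0; lra).
  rewrite in_itv /= lt_min => /and3P[q1 q2 q3]; exists q; split => //.
  by rewrite lt_eqF.
exists q; move: (ratr q) qn0 xq qm => z zn0 xz zm.
split; first by rewrite normr_gt0 zn0 ltr_norml; lra.
  by rewrite gtr0_norm; lra.
have D0 : 0 < 1 / 2 - x by lra.
exists ((z - x) / (1 / 2 - x)), (1 / 2); split; first last.
- rewrite (_ : (1 - _) * x + _ = x + (z - x) / (1 / 2 - x) * (1 / 2 - x)); last by ring.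
  by rewrite divfK ?gt_eqF// subrKC.
- by rewrite ger0_norm; lra.
rewrite divr_ge0 ?ler_pdivrMr//=; [|lra..].
have : s * (1 / 2) <= s * (1 / 2 - x) by rewrite ler_wpM2l; lra.
by lra.
Qed.

Variables (P : probability T R) (Tf Ti : T -> T) (pp pm : T -> R).
Hypotheses (mTf : measurable_fun setT Tf) (mTi : measurable_fun setT Ti).
Hypotheses (TfK : cancel Tf Ti) (TiK : cancel Ti Tf).
Hypothesis TfP : forall A, measurable A -> P (Tf @^-1` A) = P A.
Hypothesis erg : forall A, measurable A -> Tf @^-1` A = A -> P A = 0%E \/ P A = 1%E.
Hypotheses (mpp : measurable_fun setT pp) (mpm : measurable_fun setT pm).
Hypotheses (pp0 : forall x, 0 < pp x) (pm0 : forall x, 0 < pm x).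
Hypothesis pp_pm : forall x, pp x + pm x = 1.
Hypotheses (Ipp : intg P (fun x => ln (pp x))) (Ipm : intg P (fun x => ln (pm x))).

Lemma quenched_lower (v : R) : 0 < `|v| < 1 ->
  \forall w \ae P, forall alpha : R, (alpha%:E < - rateI P Tf pp pm v)%E ->
    forall eps : R, 0 < eps -> exists n0, forall n, (n0 <= n)%N ->
    expR (n%:R * alpha) <= quenched_prob Tf Ti pp pm w n [set x | `|x - v| < eps].
Proof.
have [v0|v0] := ger0P v => v01; first exact: quenched_lower_pos.
have TiP' := TiP mTi TfK TfP; have Ti_erg' := Ti_erg TfK erg.
have pm_pp x : pm x + pp x = 1 by rewrite addrC.
have := quenched_lower_pos mTi mTf TiK TfK TiP' Ti_erg' mpm mpp pm0 pp0 pm_pp Ipm Ipp v01.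
apply: filterS => w Hw alpha; rewrite -(rateI_swap P pp pm v TfK TiK) => /Hw H eps /H [n0 {}H].
by exists n0 => n /H; rewrite quenched_prob_swap.
Qed.

Theorem ldp_lower_bound : \forall w \ae P, forall A : set R, open A ->
  (- ereal_inf (rateI P Tf pp pm @` A)
    <= limn_einf (fun n => elog (quenched_prob Tf Ti pp pm w n A) * (n%:R^-1)%:E))%E.
Proof.
have H (q : rat) : \forall w \ae P, 0 < `|ratr q : R| < 1 ->
    forall alpha : R, (alpha%:E < - rateI P Tf pp pm (ratr q))%E ->
    forall eps : R, 0 < eps -> exists n0, forall n, (n0 <= n)%N ->
    expR (n%:R * alpha) <= quenched_prob Tf Ti pp pm w n [set x | `|x - ratr q| < eps].
  have [q01|_] := boolP (0 < `|ratr q : R| < 1); last exact: aeW.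
  by apply: filterS (quenched_lower q01) => w.
have key (a i c t b : R) : i < - a -> t * (c - i) <= t * b -> t * b <= (- a - i) / 2 ->
  (1 - t) * i + t * c < - a by move=> *; lra.
have {H} := ae_forall_countType H.
apply: filterS => w Hw A oA; rewrite leeNl; apply: le_ereal_inf_tmp => _ [x Ax <-].
rewrite leeNl; apply: lee_dense => a; rewrite lteNr => Ia.
have x1 : `|x| <= 1.
  rewrite leNgt; apply/negP => /(rateI_pinfty P Tf pp0 pm0 pp_pm) Ix.
  by move: Ia; rewrite Ix.
have [i Ei] : exists i : R, rateI P Tf pp pm x = i%:E.
  have := rateI_ge0 P Tf pp0 pm0 pp_pm x; move: Ia.
  by case: (rateI _ _ _ _ x) => [i| |] //; exists i.
have {}Ia : i < - a by rewrite Ei in Ia; rewrite -lte_fin EFinN.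
have [c Hc] := rateI_bounded Tf pp0 pm0 pp_pm Ipp Ipm.
have /nbhs_ballP[e /= e0 He] := oA x Ax.
(* A weight t <= s changes the rate by at most t b, half of the gap between i and - a. The bound e /
   2 on s keeps the ball of radius e / 2 about q inside [A]. *)
pose b := `|c - i| + 1; have b0 : 0 < b by rewrite /b ltr_wpDl.
pose s := Num.min (Num.min 1 (e / 2)) ((- a - i) / b / 2).
have ab0 : 0 < (- a - i) / b by rewrite divr_gt0// subr_gt0.
have s0 : 0 < s by rewrite !lt_min; lra.
have [s1 se sab] : [/\ s <= 1, s <= e / 2 & s <= (- a - i) / b / 2].
  by rewrite !ge_min !lexx !orbT.
have [q [q01 qx [t [y [/andP[t0 ts] y1 E]]]]] := rat_approx x1 s0.
have Iq : (a%:E < - rateI P Tf pp pm (ratr q))%E.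
  rewrite lteNr E; have t01 : 0 <= t <= 1 by rewrite t0 (le_trans ts).
  apply: le_lt_trans (rateI_convex pp0 pm0 pp_pm Ipp t01 _ (Hc y y1)) _.
    by rewrite Ei.
  rewrite -EFinN lte_fin.
  apply: (key _ _ _ _ b Ia).
    by rewrite ler_wpM2l// /b; have := ler_norm (c - i); lra.
  by rewrite -ler_pdivlMr// mulrAC; exact: le_trans sab.
have [n0 Hn0] := Hw q q01 a Iq (e / 2) ltac:(lra).
apply: (@limn_einf_ge_near _ _ _ n0.+1) => n n0n.
apply: elog_div_ge; first exact: leq_trans n0n.
apply: le_trans (Hn0 n (ltnW n0n)) _; rewrite !(quenched_probE pp pm TfK TiK).
apply: walk_expect_le => [z|z|z _]; [exact: ltW|exact: ltW|].
rewrite ler_nat; case: asboolP => // zq; rewrite asboolT//; apply: He.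
rewrite /ball /= distrC -[_ - x](subrKA (ratr q)).
by apply: le_lt_trans (ler_normD _ _) _; move: zq => /=; lra.
Qed.

End Lower.

(** * Removing the zeros of the transition probabilities *)

Section Regularization.
Context {d : measure_display} {T : measurableType d} {R : realType}.
Variable P : probability T R.

Lemma Lambda_ae_eq Tf (pp pm pp' pm' : T -> R) :
  (\forall x \ae P, pp' x = pp x /\ pm' x = pm x) -> Lambda P Tf pp' pm' = Lambda P Tf pp pm.
Proof.
move=> H; apply/funext => l; rewrite /Lambda; congr (ereal_inf _); apply: eq_imagel => F KF.
by apply: eq_ess_sup; apply: filterS H => x [-> ->].
Qed.

(** The walk reads the environment only along the two-sided orbit of [w]. *)
Lemma quenched_prob_on_orbit (Tf Ti : T -> T) (pp pm pp' pm' : T -> R) w n A :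
  on_orbit Tf Ti (fun x => pp' x = pp x /\ pm' x = pm x) w ->
  quenched_prob Tf Ti pp' pm' w n A = quenched_prob Tf Ti pp pm w n A.
Proof.
move=> H; apply: eq_bigr => s _; elim: (tval s) (0 : int) => [|b s' IH] z //=.
have [-> ->] : pp' (Tpow Tf Ti z w) = pp (Tpow Tf Ti z w) /\
    pm' (Tpow Tf Ti z w) = pm (Tpow Tf Ti z w).
  by case: z => k; [have [] := H k|have [] := H k.+1].
by rewrite IH.
Qed.

Lemma integrable_elog (p : T -> R) : measurable_fun setT p -> (forall x, 0 <= p x <= 1) ->
  (\int[P]_x (- elog (p x)) < +oo)%E -> P.-integrable setT (fun x => - elog (p x))%E.
Proof.
move=> mp p01 H; apply/integrableP; split.
  apply/measurableT_comp => //; rewrite /elog; apply: measurable_fun_ifT => //.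
    exact: measurable_fun_eqr.
  by apply/measurable_EFinP; exact: measurableT_comp.
apply: le_lt_trans H; rewrite le_eqVlt; apply/orP; left; apply/eqP.
apply: eq_integral => x _; rewrite gee0_abs// /elog; case: ifP => // _.
by rewrite -EFinN lee_fin oppr_ge0 ln_le0//; have /andP[] := p01 x.
Qed.

(** As [elog 0] is -oo, a finite integral forces the zeros of [p] into a null set. *)
Lemma elog_ae_gt0 (p : T -> R) : measurable_fun setT p -> (forall x, 0 <= p x <= 1) ->
  (\int[P]_x (- elog (p x)) < +oo)%E -> \forall x \ae P, 0 < p x.
Proof.
move=> mp p01 /(integrable_elog mp p01) /integrable_ae => /(_ measurableT).
apply: filterS => x /(_ I); rewrite /elog; case: eqP => // /eqP p0 _.
by rewrite lt_neqAle eq_sym p0; have /andP[] := p01 x.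
Qed.

(** The function [- elog p + ln 2] dominates both cases, its second term accounting for the value
    1/2. *)
Lemma intg_ln_regularization (p : T -> R) (c : T -> bool) :
  measurable_fun setT p -> measurable_fun setT c -> (forall x, 0 <= p x <= 1) ->
  (forall x, c x -> 0 < p x) ->
  (\int[P]_x (- elog (p x)) < +oo)%E ->
  intg P (fun x => ln (if c x then p x else 2^-1)).
Proof.
move=> mp mc p01 cp H; have I := integrable_elog mp p01 H.
have I2 := integrableD measurableT I (intg_cst P (ln 2)).
apply: le_integrable I2 => //.
  apply/measurable_EFinP; apply: measurableT_comp => //.
  exact: measurable_fun_ifT.
have ln2 : 0 <= ln 2 :> R by rewrite ln_ge0// ler1n.
move=> x _; rewrite [leRHS]gee0_abs /=; last first.
  rewrite adde_ge0 ?lee_fin// /elog; case: ifP => // _.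
  by rewrite -EFinN lee_fin oppr_ge0 ln_le0//; have /andP[] := p01 x.
have /andP[_ p1] := p01 x.
case: ifP => [/cp px|_]; last first.
  rewrite lnV ?posrE// normrN (ger0_norm ln2) leeDr// /elog; case: ifP => // _.
  by rewrite -EFinN lee_fin oppr_ge0 ln_le0.
rewrite /elog gt_eqF// -EFinN -EFinD lee_fin ler0_norm ?ln_le0//.
by rewrite lerDl.
Qed.

End Regularization.

Theorem theorem5p3 (d : measure_display) (T : measurableType d) (R : realType)
  (P : probability T R) (Tf Ti : T -> T) (pp pm : T -> R) :
  measurable_fun setT Tf -> measurable_fun setT Ti ->
  cancel Tf Ti -> cancel Ti Tf ->
  (forall A, measurable A -> P (Tf @^-1` A) = P A) ->
  (forall A, measurable A -> Tf @^-1` A = A -> P A = 0%E \/ P A = 1%E) ->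
  measurable_fun setT pp -> measurable_fun setT pm ->
  (forall x, 0 <= pp x <= 1) -> (forall x, 0 <= pm x <= 1) ->
  (forall x, pp x + pm x = 1) ->
  (\int[P]_x (- elog (pp x)) < +oo)%E ->
  (\int[P]_x (- elog (pm x)) < +oo)%E ->
  \forall w \ae P,
    (forall C : set R, closed C ->
       (limn_esup (fun n => elog (quenched_prob Tf Ti pp pm w n C) * (n%:R^-1)%:E)
          <= - ereal_inf (rateI P Tf pp pm @` C))%E) /\
    (forall O : set R, open O ->
       (- ereal_inf (rateI P Tf pp pm @` O)
          <= limn_einf (fun n => elog (quenched_prob Tf Ti pp pm w n O) * (n%:R^-1)%:E))%E).
Proof.
move=> mTf mTi TfK TiK TfP erg mpp mpm pp01 pm01 pp_pm Hpp Hpm.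
(* p+ and p- are positive almost surely; the junk value 1/2 makes them so everywhere. *)
pose c x := (0 < pp x) && (0 < pm x).
pose pp' x := if c x then pp x else 2^-1; pose pm' x := if c x then pm x else 2^-1.
have mc : measurable_fun setT c.
  by apply: measurable_and; exact: measurable_fun_ltr.
have mpp' : measurable_fun setT pp' by exact: measurable_fun_ifT.
have mpm' : measurable_fun setT pm' by exact: measurable_fun_ifT.
have pp'0 x : 0 < pp' x by rewrite /pp'; case: ifP => [/andP[]|].
have pm'0 x : 0 < pm' x by rewrite /pm'; case: ifP => [/andP[]|].
have pp'_pm' x : pp' x + pm' x = 1 by rewrite /pp' /pm'; case: ifP => // _; lra.
have Ipp : intg P (fun x => ln (pp' x)).
  by apply: intg_ln_regularization => // x /andP[].
have Ipm : intg P (fun x => ln (pm' x)).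
  by apply: intg_ln_regularization => // x /andP[].
have E : \forall x \ae P, pp' x = pp x /\ pm' x = pm x.
  move: (elog_ae_gt0 mpp pp01 Hpp) (elog_ae_gt0 mpm pm01 Hpm).
  by apply: filterS2 => x px mx; rewrite /pp' /pm' /c px mx.
have EI : rateI P Tf pp' pm' = rateI P Tf pp pm by rewrite /rateI (Lambda_ae_eq _ E).
move: (ae_on_orbit mTf mTi TfK TfP E)
  (ldp_upper_bound mTf mTi TfK TiK TfP erg pp'0 pm'0 pp'_pm' Ipp)
  (ldp_lower_bound mTf mTi TfK TiK TfP erg mpp' mpm' pp'0 pm'0 pp'_pm' Ipp Ipm).
apply: filterS3 => w Ew; rewrite EI => up lo; split=> A hA.
  under eq_fun do rewrite -(quenched_prob_on_orbit _ _ Ew); exact: up.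
under eq_fun do rewrite -(quenched_prob_on_orbit _ _ Ew); exact: lo.
Qed.
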